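(* There exists an absolute constant $C>0$ such that the following holds. Let $d$ be a positive integer and let $q\ge2$ be a real number. Let $\chi$ be an irreducible character of $S_n$ of level $d$. Then $$\|\chi\|_q\le\left(\frac{Cq}{\log q}\right)^{d}\left(\frac{d^{d}\chi(1)}{n^{d}}\right)^{1-2/q}.$$
   Context: $S_n$ is the symmetric group on $n$ letters, and irreducible characters are the complex irreducible characters $\chi_\lambda$ indexed by partitions $\lambda=(\lambda_1\ge\lambda_2\ge\cdots)$ of $n$. Write $\lambda'$ for the conjugate partition (transposed Young diagram), so $\lambda_1'$ is the number of parts of $\lambda$. The level of $\chi_\lambda$ is $\min(n-\lambda_1,\,n-\lambda_1')$. For a function $f$ on $S_n$, $\|f\|_q=\big(\frac{1}{n!}\sum_{\sigma\in S_n}|f(\sigma)|^q\big)^{1/q}$. The logarithm is natural. *)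

(* Defs.v *)
From HB Require Import structures.
From mathcomp Require Import all_boot all_order all_algebra all_fingroup.
From mathcomp Require Import all_field all_character.
From mathcomp Require Import all_classical all_reals all_analysis.

Set Implicit Arguments.
Unset Strict Implicit.
Unset Printing Implicit Defensive.

Import Order.TTheory GRing.Theory Num.Theory.

Local Open Scope ring_scope.

Definition is_part (n : nat) (la : seq nat) : bool :=
  [&& sorted geq la, 0%N \notin la & sumn la == n].

Definition conj_part (la : seq nat) : seq nat :=
  [seq count (fun k => (i < k)%N) la | i <- iota 0 (head 0%N la)].

Definition part_level (n : nat) (la : seq nat) : nat :=
  minn (n - head 0%N la) (n - head 0%N (conj_part la)).

(* The letters 0, ..., n - 1 fill the Young diagram of la row by row: the
   letter k sits in row [reshape_index la k], column [reshape_offset la k]. *)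
Definition row_stab (n : nat) (la : seq nat) : pred 'S_n := fun s =>
  [forall k : 'I_n, reshape_index la (s k) == reshape_index la k].

Definition col_stab (n : nat) (la : seq nat) : pred 'S_n := fun s =>
  [forall k : 'I_n, reshape_offset la (s k) == reshape_offset la k].

Definition symg (n : nat) : {group 'S_n} := [set: 'S_n]%G.

(* The Young symmetrizer a_la * b_la, an element of the group algebra, encoded
   by its action in the regular representation. *)
Definition young_symmetrizer (n : nat) (la : seq nat) :
    'M[algC]_#|symg n| :=
  (\sum_(s : 'S_n | row_stab la s) regular_repr algC (symg n) s) *m
  (\sum_(s : 'S_n | col_stab la s)
     (-1) ^+ odd_perm s *: regular_repr algC (symg n) s).

(* The Specht module, as the ideal of the group algebra generated by the Young
   symmetrizer. Representations act on the right in MathComp, so this is a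
   right ideal. *)
Definition specht_module (n : nat) (la : seq nat) : 'M[algC]_#|symg n| :=
  cyclic_mx (regular_repr algC (symg n))
    (gring_row (young_symmetrizer n la)).

Definition specht_repr (n : nat) (la : seq nat) :
    mx_representation algC (symg n) (\rank (specht_module n la)) :=
  submod_repr (cyclic_mx_module (regular_repr algC (symg n))
    (gring_row (young_symmetrizer n la))).

Definition part_char (n : nat) (la : seq nat) : 'CF(symg n) :=
  cfRepr (specht_repr n la).

Definition has_level (n : nat) (chi : 'CF(symg n)) (d : nat) : Prop :=
  exists la : seq nat,
    [/\ is_part n la, chi = part_char n la & part_level n la = d].

(* The modulus of an algebraic complex number as an element of R: algC has no
   canonical map to R, but `|x| is a real algebraic number, determined by the
   rational numbers below it. *)
Definition algC_modulus (R : realType) (x : algC) : R :=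
  sup (ratr @` [set r : rat | (ratr r : algC) <= `|x|])%classic.

Definition sym_Lnorm (R : realType) (n : nat) (q : R) (f : 'S_n -> algC) : R :=
  ((n`!)%:R^-1 * \sum_(s : 'S_n) algC_modulus R (f s) `^ q) `^ q^-1.

(* Main.v *)
Require Import Defs.
From mathcomp Require Import all_boot all_order all_algebra all_fingroup.
From mathcomp Require Import all_field all_character.
From mathcomp Require Import zify ring lra.

Set Implicit Arguments.
Unset Strict Implicit.
Unset Printing Implicit Defensive.

Import Order.TTheory GRing.Theory Num.Theory.

(** Write f for chi, or for chi times the sign when the level of chi is
    attained on the columns. Everything is read off from the coefficients
    M(a, b) (mcoef), the sum of f over the permutations s with s o a = b, where
    a is an injection of d letters into the n letters.

    The level enters through the Young symmetrizer and the pigeonhole principle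
    (level_twist): the sum of f over a coset of the pointwise stabilizer of fewer
    than d letters vanishes, whereas M(a, a), the same for all a, is not zero.
    Schur's lemma then says that f(1) times the sum of M(a, y o a) over all a is a multiple of f(y)
    (mcoef_expand), and Parseval's identity bounds the values M(a, a o t), t in
    S_d, in l^2 and in l^oo by M(a, a) (mcoef_sum2, mcoef_le).

    The partial permutation a i |-> y (a i) of the image of a consists of
    cycles and paths. Since M(a, .) has sum zero in each coordinate of its
    argument, the end of a path can be joined to the beginning of a path at the
    cost of a factor about 1 / n, and so M(a, y o a) is controlled by the values
    M(a, a o t) for the permutations t that extend the partial permutation
    (mcoef_close). The number of ways to place the paths compensates the powers
    of 1 / n, and what is left is a bound of |f(y)| by a multiple of 4 ^ d times
    the sum of |M(a, a o t)| over the pairs (p, t) where p is a partial injection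
    with y o p = p o t, that is, an identification of some cycles of t with
    some cycles of y (pointwise_bound).

    By the power mean inequality the L^q norm of this sum is reduced to the
    moments of the number Z(y) of y-invariant sets of at most d letters.
    Z(y) ^ Q counts Q-tuples of invariant sets, so that by Burnside's lemma the
    moment is a number of orbits of S_n on Q-tuples of small sets, that is, on
    colourings of the letters by subsets of 'I_Q. With weight u ^ #|S| for the
    colour S, the generating function of these orbits is at most
    exp (2 (1 + u) ^ Q), and u = log q / q makes it exp (2 q) at the
    price of the factor u ^ (- d Q); this is where (q / log q) ^ d comes
    from. The interpolation exponent 1 - 2 / q comes from
    |M| ^ q <= |M| ^ 2 sup |M| ^ (q - 2). All this needs n >= 3 d; if n < 3 d the
    factor (d / n) ^ d is at least 3 ^ (- d), and |chi| <= chi(1) together with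
    the L^2 norm of chi suffices. *)

(** * Counting with a group of permutations *)

Lemma eq_fibers_perm (n : nat) (C : finType) (u v : 'I_n -> C) :
  (forall c, #|[pred i | u i == c]| = #|[pred i | v i == c]|) ->
  exists s : 'S_n, forall i, v i = u (s i).
Proof.
move=> euv.
have /tuple_permP[s Es] : perm_eq (mktuple v) (mktuple u).
  apply/allP => c _.
  have cE (w : 'I_n -> C) : count_mem c (mktuple w) = #|[pred i | w i == c]|.
    rewrite /= !count_map -enumT -sum1_count big_enum_cond -sum1_card.
    by apply: eq_bigl => i; rewrite !inE.
  by apply/eqP; rewrite !cE euv.
exists s => i.
have -> : v i = tnth (mktuple v) i by rewrite tnth_mktuple.
have -> : mktuple v = [tuple tnth (mktuple u) (s i)  | i < n] by exact/val_inj.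
by rewrite !tnth_mktuple.
Qed.

Lemma eq_fibers_perm_but (n : nat) (C : finType) (c0 : C) (u v : 'I_n -> C) :
  (forall c, c != c0 -> #|[pred i | u i == c]| = #|[pred i | v i == c]|) ->
  exists s : 'S_n, forall i, v i = u (s i).
Proof.
move=> euv; apply: eq_fibers_perm => c.
have [->|/euv//] := eqVneq c c0.
have sumE (w : 'I_n -> C) : (n = \sum_c #|[pred i | w i == c]|)%N.
  rewrite -[LHS]card_ord -sum1_card (partition_big w xpredT) //=.
  by apply: eq_bigr => c' _; rewrite -sum1_card; apply: eq_bigl => i; rewrite !inE.
have := sumE u; rewrite {1}(sumE v) (bigD1 c0) //= (bigD1 c0 (F := fun c => #|[pred i
  | u i == c]|)) //=.
by rewrite (eq_bigr (fun c => #|[pred i | u i == c]|)) => [/addIn//|c' /euv].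
Qed.

(** Let [x0] be an element of type [k], and [act x0 (h x) = x] for the others.
    A solution of [act x g = phi x] gives [act x0 (mul (h x) g) = phi x], so
    [mul (h x) g] determines [x], as [phi] is injective, and then [g]. For
    [phi = id] this is orbit counting. The operation [mul] is a parameter so
    that left and right actions are both covered. *)
Lemma twisted_burnside (G X K : finType) (act : X -> G -> X) (mul : G -> G -> G)
    (P : pred X) (phi : X -> X) (ty : X -> K) (k : K) :
  (forall x g h, act (act x g) h = act x (mul g h)) ->
  (forall g, injective (mul g)) -> injective phi ->
  (forall x y, P x -> P y -> ty x = ty y -> exists g, act x g == y) ->
  (#|[pred z : X * G | [&& P z.1, ty z.1 == k & act z.1 z.2 == phi z.1]]|
     <= #|G|)%N.
Proof.
move=> actM mulI phiI trans.
have [|no] := boolP [exists z : X * G, P z.1 && (ty z.1 == k)]; last first.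
  rewrite eq_card0 // => -[x g]; rewrite !inE /=; apply/negP => /and3P[Px tx _].
  by case/existsP: no; exists (x, g); rewrite Px.
case/existsP=> -[x0 g0] /= /andP[Px0 /eqP tx0].
pose h x := odflt g0 [pick g | act x0 g == x].
have hP x : P x -> ty x = k -> act x0 (h x) = x.
  move=> Px tx; rewrite /h; case: pickP => [g /eqP //|no].
  have [g /eqP eg] := trans x0 x Px0 Px (etrans tx0 (esym tx)).
  by have := no g; rewrite eg eqxx.
rewrite -(@card_in_imset _ _ (fun z : X * G => mul (h z.1) z.2)); first exact: max_card.
move=> [x g] [y g']; rewrite !inE /= => /and3P[Px /eqP tx /eqP ex].
move=> /and3P[Py /eqP ty_ /eqP ey] emul.
have exy : x = y.
  apply: phiI; rewrite -ex -ey -{1}(hP x) // -{1}(hP y) // !actM.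
  by rewrite emul.
by move: emul; rewrite exy => /mulI ->.
Qed.

(** * Partial injections and invariant sets *)

Section PartialInjections.
Variables (d n : nat).
Implicit Types (p : {ffun 'I_d -> option 'I_n}).

(** [None] marks the indices outside the domain of [p]. *)
Definition pinj p := [forall i, forall j, (p i == p j) ==> p i ==> (i == j)].

Lemma pinjP p : reflect (forall i j y, p i = Some y -> p j = Some y -> i = j) (pinj p).
Proof.
apply: (iffP forallP) => [H i j y pi pj|H i].
  by have /forallP/(_ j) := H i; rewrite pi pj eqxx /= => /eqP.
apply/forallP => j; apply/implyP => /eqP e; apply/implyP.
case E: (p i) => [y|//] _; apply/eqP; by apply: (H _ _ y); rewrite -?e E.
Qed.

Definition pimg p : {set 'I_n} := [set y | [exists i, p i == Some y]].

Lemma pimgP p y : reflect (exists i, p i = Some y) (y \in pimg p).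
Proof. by rewrite inE; apply: (iffP existsP) => -[i /eqP pi]; exists i; rewrite pi. Qed.

Lemma card_pimg p : (#|pimg p| <= d)%N.
Proof.
rewrite -[X in (_ <= X)%N]card_ord -(card_imset _ (@Some_inj _)).
apply: leq_trans (leq_imset_card p 'I_d); apply: subset_leq_card.
apply/subsetP => o /imsetP[y /pimgP[i pi] ->].
by apply/imsetP; exists i.
Qed.

Lemma pinj_trans p p' : pinj p -> pinj p' -> pimg p = pimg p' ->
  exists t : 'S_d, forall i, p' i = p (t i).
Proof.
move=> /pinjP pI /pinjP pI' e.
have cS (q : {ffun 'I_d -> option 'I_n}) : (forall i j y, q i = Some y -> q j = Some y
  -> i = j) ->
    forall y, #|[pred i | q i == Some y]| = (y \in pimg q).
  move=> qI y; case: pimgP => [[i qi]|no] /=.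
    rewrite -(card1 i); apply: eq_card => j; rewrite !inE.
    by apply/eqP/eqP => [qj|->//]; apply: qI qj qi.
  by rewrite eq_card0 // => i; rewrite !inE; apply/eqP => qi; case: no; exists i.
apply: (@eq_fibers_perm_but _ _ None) => -[y _|//].
by rewrite !cS ?e.
Qed.

(** The domain of [p] is then invariant under [t] and its image under [s], so
    that [p] identifies some cycles of [t] with some cycles of [s]. *)
Definition intertwines (s : 'S_n) (t : 'S_d) p := [forall i, omap s (p i) == p (t i)].

Definition inv_sets (s : 'S_n) :=
  [pred A : {set 'I_n} | (#|A| <= d)%N && (s @: A == A)].

(** The image of [p] is one of the invariant sets, and 'S_d permutes transitively
    the partial injections with a given image. So there are at most d! pairs
    for each image. *)
Lemma card_intertwines (s : 'S_n) :
  (#|[pred z : {ffun 'I_d -> option 'I_n} * 'S_d | pinj z.1 && intertwines s z.2 z.1]|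
     <= d`! * #|inv_sets s|)%N.
Proof.
rewrite -sum1_card (partition_big (fun z => pimg z.1) (mem (inv_sets s))) /=;
  last first.
  move=> [p t] /andP[/= /pinjP pI /forallP st]; rewrite !inE card_pimg /=.
  rewrite eqEcard card_imset ?leqnn ?andbT; last exact: perm_inj.
  apply/subsetP => _ /imsetP[y /pimgP[i pi] ->].
  apply/pimgP; exists (t i).
  by have /eqP <- := st i; rewrite pi.
rewrite mulnC -sum_nat_const; apply: leq_sum => A _.
rewrite sum1_card.
have -> : d`! = #|'S_d| by rewrite card_Sn.
pose act (p : {ffun 'I_d -> option 'I_n}) (t : 'S_d) := [ffun i => p (t i)].
pose phi p := [ffun i => omap s (p i)] : {ffun 'I_d -> option 'I_n}.
have aM x g h : act (act x g) h = act x (h * g)%g.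
  by apply/ffunP => i; rewrite !ffunE permM.
have phiI : injective phi.
  move=> p p' /ffunP e; apply/ffunP => i; have := e i; rewrite !ffunE.
  by case: (p i) (p' i) => [y|] [y'|] //= [/perm_inj->].
have tr p p' : pinj p -> pinj p' -> pimg p = pimg p' -> exists t, act p t == p'.
  move=> P1 P2 e; have [t et] := pinj_trans P1 P2 e; exists t.
  by apply/eqP/ffunP => i; rewrite ffunE et.
apply: leq_trans (twisted_burnside A aM (fun g => mulIg g) phiI tr);
  apply: subset_leq_card; apply/subsetP => -[p t]; rewrite !inE /=.
move=> /andP[/andP[-> /forallP st] ->] /=; apply/eqP/ffunP => i; rewrite !ffunE.
by have /eqP -> := st i.
Qed.

End PartialInjections.

(** * Moments of the number of invariant sets *)

Section Moment.
Variables (R : realFieldType) (d n Q : nat) (tau : 'S_d) (t : R).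
Hypotheses (t0 : (0 < t)%R) (t1 : (t <= 1)%R).

Local Notation FF := {ffun 'I_Q -> {set 'I_n}}.
Definition color (F : FF) (y : 'I_n) : {set 'I_Q} := [set i | y \in F i].

(** The entry at [set0] is determined by the others and is set to zero. *)
Definition tally (F : FF) : {ffun {set 'I_Q} -> 'I_n.+1} :=
  [ffun S => if S == set0 then ord0 else inord #|[pred y | color F y == S]|].

(** A complete invariant of a partial injection and [Q] sets up to a relabelling
    of the [n] letters. *)
Definition marked_type (x : {ffun 'I_d -> option 'I_n} * FF) :=
  ([ffun i => omap (color x.2) (x.1 i)] : {ffun 'I_d -> option {set 'I_Q}}, tally x.2).
Definition marked_act (x : {ffun 'I_d -> option 'I_n} * FF) (s : 'S_n) :=
  ([ffun i => omap s (x.1 i)] : {ffun 'I_d -> option 'I_n}, [ffun i => s @: x.2 i] :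
    FF).

Lemma tallyE F S : S != set0 -> tally F S = #|[pred y | color F y == S]| :> nat.
Proof.
move=> S0; rewrite ffunE (negbTE S0) inordK // ltnS.
by rewrite -[X in (_ <= X)%N]card_ord max_card.
Qed.

(** Label each letter by its index under the partial injection, if any, and by
    its colour. Two labellings with the same number of letters for each
    label differ by a permutation, and these numbers can be read off from the
    type, except for the unindexed letters of colour [set0], whose number
    follows from the others. *)
Lemma marked_trans x y : pinj x.1 -> pinj y.1 -> marked_type x = marked_type y ->
  exists s, marked_act x s == y.
Proof.
case: x y => [p F] [p' F'] /= /pinjP pI /pinjP pI' [ep eF].
pose lab (q : {ffun 'I_d -> option 'I_n}) z := [pick i | q i == Some z].
have labP (q : {ffun 'I_d -> option 'I_n}) (qI : forall i j y, q i = Some y -> q j =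
  Some y -> i = j) z i :
    (lab q z == Some i) = (q i == Some z).
  rewrite /lab; case: pickP => [j /eqP qj|no]; last by rewrite no.
  by apply/eqP/eqP => [[<-]//|qi]; congr Some; apply: qI qj qi.
pose cu z := (lab p z, color F z); pose cv z := (lab p' z, color F' z).
have cS i S (q : {ffun 'I_d -> option 'I_n}) G (qI : forall i j y, q i = Some y -> q j
  = Some y -> i = j) :
   #|[pred z | (lab q z, color G z) == (Some i, S)]| = (omap (color G) (q i) == Some S).
  case E: (q i) => [z|] /=; last first.
    by rewrite eq_card0 // => z; rewrite !inE xpair_eqE labP // E.
  case: eqP => [[eS]|nS] /=.
    rewrite -(card1 z); apply: eq_card => z'; rewrite !inE xpair_eqE labP // E.
    apply/andP/eqP => [[/eqP[->]]//|->]; by rewrite eS !eqxx.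
  rewrite eq_card0 // => z'; rewrite !inE xpair_eqE labP // E;
    apply/negP => /andP[/eqP[<-] /eqP e].
  by apply: nS; rewrite e.
have cT S (q : {ffun 'I_d -> option 'I_n}) G :
    #|[pred z | color G z == S]| =
    (\sum_o #|[pred z | (lab q z, color G z) == (o, S)]|)%N.
  rewrite -sum1_card (partition_big (lab q) xpredT) //=; apply: eq_bigr => o _.
  by rewrite -sum1_card; apply: eq_bigl => z; rewrite !inE xpair_eqE andbC.
have cN (q : {ffun 'I_d -> option 'I_n}) G S (qI : forall i j y, q i = Some y -> q j =
  Some y -> i = j) :
   (#|[pred z | color G z == S]| =
    #|[pred z | (lab q z, color G z) == (None, S)]| + \sum_i (omap (color G) (q i) ==
      Some S))%N.
  rewrite (cT S q) (bigD1 None) //=; congr (_ + _)%N.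
  rewrite [RHS](eq_bigr (fun i => #|[pred z | (lab q z, color G z) == (Some i, S)]|));
    last first.
    by move=> i _; rewrite cS.
  rewrite (reindex_omap Some id) /=; last by case.
  by apply: eq_bigl => i; rewrite eqxx.
have epi i : omap (color F) (p i) = omap (color F') (p' i).
  by have /ffunP/(_ i) := ep; rewrite !ffunE.
have [s es] : exists s : 'S_n, forall z, cu z = cv (s z).
  apply: (@eq_fibers_perm_but _ _ (None, set0)) => -[[i|] S] nz; rewrite /cu /cv.
    by rewrite !cS // epi.
  have S0 : S != set0 by apply: contraNneq nz => ->.
  have := tallyE F S0; rewrite eF tallyE // (cN p F) // (cN p' F') //.
  by rewrite (eq_bigr _ (fun i _ => congr1 (fun o => nat_of_bool (o == Some S)) (epi
    i))) => /addIn.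
exists s; apply/eqP; congr pair; apply/ffunP => i; rewrite ffunE /=.
  have := labP p' pI' ; have := labP p pI => lp lp'.
  case E: (p i) => [z|] /=.
    have /eqP lz : lab p z == Some i by rewrite lp E.
    have [e1 _] := es z; symmetry; apply/eqP; rewrite -lp' -e1; exact/eqP.
  by have := epi i; rewrite E; case: (p' i).
apply/setP => z; rewrite -(permKV s z) mem_imset; last exact: perm_inj.
by have [_ /setP/(_ i)] := es (s^-1 z)%g; rewrite !inE permKV.
Qed.

Local Notation PX := ({ffun 'I_d -> option 'I_n} * FF)%type.
Definition marked_ok (x : PX) := pinj x.1 && [forall i, (#|x.2 i| <= d)%N].
Definition marked_twist (x : PX) : PX := ([ffun i => x.1 (tau i)], x.2).

Lemma card_marked_fix (s : 'S_n) :
  (#|inv_sets d s| ^ Q * #|[pred p | pinj p && intertwines s tau p]|)%N =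
  #|[pred x : PX | marked_ok x && (marked_act x s == marked_twist x)]|.
Proof.
have := @card_ffun_on 'I_Q _ (inv_sets d s); rewrite card_ord => <-.
rewrite mulnC -cardX; apply: eq_card => -[p F].
rewrite !inE /marked_ok /= /marked_act /marked_twist /= xpair_eqE -!andbA; congr andb.
have -> : ([ffun i => omap s (p i)] == [ffun i => p (tau i)]) = intertwines s tau p.
  by apply/eqP/forallP => [/ffunP e i|e]; [have := e i;
    rewrite !ffunE => -> | apply/ffunP => i; have /eqP := e i; rewrite !ffunE].
rewrite andbCA; congr andb.
apply/ffun_onP/andP => [H|[/forallP H /eqP/ffunP e] i].
  split; first by apply/forallP => i; have /andP[] := H i.
  by apply/eqP/ffunP => i; rewrite ffunE; have /andP[_ /eqP] := H i.
by rewrite !inE H; have := e i; rewrite ffunE => ->; rewrite eqxx.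
Qed.

Local Open Scope ring_scope.

(** Every letter of colour [S] contributes [t ^+ #|S|]. The factor at [set0] is
    the indicator of the value that [tally] takes there. *)
Definition tally_weight (c : {ffun {set 'I_Q} -> 'I_n.+1}) : R :=
  \prod_S (if S == set0 then (c S == ord0)%:R else t ^+ (#|S| * c S)).

(** The exponent of the weight is the sum of the sizes of the [Q] sets, which is at
    most [d * Q]. *)
Lemma tally_weight_ge (x : PX) : marked_ok x ->
  t ^+ (d * Q) <= tally_weight (marked_type x).2.
Proof.
case: x => p F /andP[_ /forallP /= FI].
have -> : tally_weight (tally F) = t ^+ (\sum_i #|F i|).
  have -> : (\sum_i #|F i| = \sum_(S | S != set0) #|S| * tally F S)%N.
    transitivity (\sum_y #|color F y|)%N.
      rewrite (eq_bigr (fun i => \sum_(y : 'I_n) (y \in F i))%N); last first.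
        by move=> i _; rewrite -sum1_card big_mkcond; apply: eq_bigr => y _; case: ifP.
      rewrite exchange_big; apply: eq_bigr => y _.
      rewrite -sum1_card [RHS]big_mkcond; apply: eq_bigr => i _; rewrite inE.
      by case: ifP.
    rewrite (partition_big (color F) xpredT) //= [RHS]big_mkcond;
      apply: eq_bigr => S _ /=.
    rewrite (eq_bigr (fun=> #|S|)) => [|y /eqP -> //].
    rewrite sum_nat_const; case: eqP => [->|/eqP S0] /=; first by rewrite cards0 muln0.
    by rewrite tallyE // mulnC; congr muln; apply: eq_card => y; rewrite !inE.
  rewrite /tally_weight (bigD1 set0) //= eqxx ffunE eqxx eqxx mul1r.
  by rewrite -prodrXr; apply: eq_bigr => S /negbTE ->.
apply: ler_wiXn2l => //; first exact: ltW.
rewrite mulnC -[X in (X * _)%N]card_ord -sum_nat_const; exact: leq_sum.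
Qed.

(** A pair of a permutation [s] and a tuple of [Q] sets invariant under [s],
    together with a partial injection [p] with [s o p = p o tau], is counted at most
    n! times for each type by [twisted_burnside]. A type consists of a
    colour or nothing for each of the [d] indices, and of a tally; weighing the
    tallies by powers of [t] turns their number into a product of geometric sums,
    one for each nonempty colour. *)
Lemma moment_inv_sets :
  (\sum_(s : 'S_n)
      #|inv_sets d s| ^ Q * #|[pred p | pinj p && intertwines s tau p]|)%:R
    * t ^+ (d * Q)
  <= n`!%:R * ((2 ^ Q).+1 ^ d)%:R
     * \prod_(S : {set 'I_Q} | S != set0) \sum_(k < n.+1) t ^+ (#|S| * k) :> R.
Proof.
pose W k := #|[pred z : PX * 'S_n | [&& marked_ok z.1, marked_type z.1 == k &
  marked_act z.1 z.2 == marked_twist z.1]]|.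
have -> : (\sum_(s : 'S_n) #|inv_sets d s| ^ Q * #|[pred p | pinj p && intertwines s
  tau p]|)%N
   = (\sum_k W k)%N.
  rewrite (eq_bigr _ (fun s _ => card_marked_fix s)) (eq_bigr (fun s => \sum_(x |
    marked_ok x && (marked_act x s == marked_twist x)) 1)%N); last first.
    by move=> s _; rewrite sum1_card.
  rewrite pair_big_dep /= (reindex_onto (fun z => (z.2, z.1)) (fun z => (z.2, z.1)))
    /=; last by case.
  rewrite (partition_big (fun z : PX * 'S_n => marked_type z.1) xpredT) //=;
    apply: eq_bigr => k _.
  rewrite sum1_card; apply: eq_card => -[x s]; rewrite unfold_in !inE /= eqxx andbT.
  by rewrite -andbA; congr (_ && _); rewrite andbC.
have Wle k : (W k)%:R * t ^+ (d * Q) <= n`!%:R * tally_weight k.2 :> R.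
  have [[x /andP[gx /eqP <-]]|no] := altP (@existsP _ (fun x => marked_ok x &&
    (marked_type x == k))); last first.
    rewrite /W eq_card0 ?mul0r => [|[x s]].
      rewrite mulr_ge0 // prodr_ge0 // => S _; case: ifP => // _; apply: exprn_ge0;
        exact: ltW.
    rewrite !inE /=; apply/negP => /and3P[gx tx _]; case/existsP: no.
    by exists x; rewrite gx.
  apply: ler_pM => //; [apply: exprn_ge0; exact: ltW| |exact: tally_weight_ge].
  rewrite ler_nat; have -> : n`! = #|'S_n| by rewrite card_Sn.
  apply: (@twisted_burnside 'S_n _ _ marked_act (fun g h => (g * h)%g) marked_ok
    marked_twist marked_type).
  - move=> [p F] g h; congr pair; apply/ffunP => i; rewrite !ffunE /=.
      by case: (p i) => //= y; rewrite permM.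
    by rewrite -imset_comp; apply: eq_imset => y /=; rewrite permM.
  - exact: mulgI.
  - move=> [p F] [p' F'] [/ffunP e ->]; congr pair; apply/ffunP => i.
    by have := e (tau^-1%g i); rewrite !ffunE permKV.
  - by move=> {gx}x y /andP[Px _] /andP[Py _]; apply: marked_trans.
rewrite natr_sum mulr_suml; apply: le_trans (ler_sum _ (fun k _ => Wle k)) _.
rewrite -mulr_sumr -mulrA ler_wpM2l //.
rewrite (eq_bigr (fun k => (fun v c => tally_weight c) k.1 k.2)) // -(pair_bigA _ (fun
  v c => tally_weight c)) /=.
have c2 : #|{: {set 'I_Q}}| = (2 ^ Q)%N by rewrite -cardsT -powersetT card_powerset
  cardsT card_ord.
rewrite sumr_const card_ffun card_option card_ord c2.
rewrite -[leLHS]mulr_natl ler_wpM2l //.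
rewrite /tally_weight -(bigA_distr_bigA (fun S (k : 'I_n.+1) =>
   if S == set0 then (k == ord0)%:R else t ^+ (#|S| * k) : R)) /=.
rewrite (bigD1 set0) //= big_ord_recl /= eqxx big1 ?addr0 ?mul1r; last first.
  by [].
rewrite le_eqVlt; apply/orP; left; apply/eqP; apply: eq_bigr => S /negbTE S0.
by apply: eq_bigr => k _; rewrite S0.
Qed.

End Moment.

Local Open Scope ring_scope.

Lemma inj_extend (d n : nat) (a b : {ffun 'I_d -> 'I_n}) :
  injective a -> injective b -> exists g : 'S_n, forall i, b i = g (a i).
Proof.
move=> aI bI.
(* Without any sets, two total injections have the same type. *)
pose x (c : {ffun 'I_d -> 'I_n}) : {ffun 'I_d -> option 'I_n} * {ffun 'I_0 -> {set
  'I_n}} :=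
  ([ffun i => Some (c i)], [ffun => set0]).
have xI (c : {ffun 'I_d -> 'I_n}) : injective c -> pinj (x c).1.
  move=> cI; apply/pinjP => i j y; rewrite !ffunE => -[<-] [] /cI; exact/esym.
have [|g /eqP[/ffunP e _]] := marked_trans (xI _ aI) (xI _ bI).
  congr pair; apply/ffunP => i; rewrite !ffunE /=; congr Some.
  by apply/setP => -[].
by exists g => i; have := e i; rewrite !ffunE => -[].
Qed.

(** * Closing the paths of a partial permutation *)

Section MatrixCoefficients.
Variables (n d : nat) (f : 'S_n -> algC).
Implicit Types (a b : {ffun 'I_d -> 'I_n}).

(** A sum over a coset of the pointwise stabilizer of the letters in [a]. For the
    character of a representation it is, up to a factor, the trace of a group
    element composed with the projection to the invariants of this stabilizer. *)
Definition mcoef a b := \sum_(s : 'S_n | [forall i, s (a i) == b i]) f s.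

Definition update b j y : {ffun 'I_d -> 'I_n} := [ffun i => if i == j then y else b i].

Hypothesis fC : forall s t, f (s * t)%g = f (t * s)%g.

Lemma mcoef_conj (g : 'S_n) a b :
  mcoef [ffun i => g (a i)] [ffun i => g (b i)] = mcoef a b.
Proof.
rewrite /mcoef (reindex_inj (@conjg_inj _ g)) /=; apply: eq_big => s.
  apply: eq_forallb => i; rewrite !ffunE permJ; exact: (inj_eq (@perm_inj _ _)).
by rewrite conjgE fC -mulgA mulgV mulg1.
Qed.

Lemma mcoef_noninj a b : injective a -> ~~ injectiveb b -> mcoef a b = 0.
Proof.
move=> aI bI; rewrite /mcoef big_pred0 // => s; apply: contraNF bI => /forallP H.
apply/injectiveP => i j e; apply: aI; apply: (@perm_inj _ s).
by rewrite (eqP (H i)) (eqP (H j)).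
Qed.

Hypothesis fV : forall (B : {set 'I_n}) g, (#|B| < d)%N ->
  \sum_(h : 'S_n | [forall x in B, h x == x]) f (h * g)%g = 0.

(** Summing over the image of the letter [a j] removes the constraint on it, and a
    coset of the stabilizer of [d - 1] letters remains. *)
Lemma mcoef_sum0 a b j : injective a -> \sum_y mcoef a (update b j y) = 0.
Proof.
move=> aI; pose P (s : 'S_n) := [forall i, (i != j) ==> (s (a i) == b i)].
have -> : \sum_y mcoef a (update b j y) = \sum_(s | P s) f s.
  rewrite (partition_big (fun s : 'S_n => s (a j)) xpredT) //=.
  apply: eq_bigr => y _; apply: eq_bigl => s;
    apply/forallP/andP => [H|[/forallP H /eqP e] i].
    split; last by have := H j; rewrite ffunE eqxx.
    by apply/forallP => i; apply/implyP => /negbTE ij; have := H i; rewrite ffunE ij.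
  by rewrite ffunE; have [->|ij] := eqVneq i j; [rewrite e|have := H i; rewrite ij].
have [[s0 /forallP P0]|no] := altP (@existsP _ P); last first.
  by rewrite big_pred0 // => s; apply: contraNF no => ?; apply/existsP; exists s.
have := @fV (a @: [set~ j]) s0; rewrite card_imset // cardsC1 card_ord.
rewrite ltn_predL (leq_ltn_trans (leq0n j) (ltn_ord j)) => /(_ isT) E0;
  rewrite -[RHS]E0.
rewrite (reindex_inj (mulIg s0)) /=; apply: eq_bigl => h.
have E i : i != j -> ((h * s0)%g (a i) == b i) = (h (a i) == a i).
  move=> ij; have := P0 i; rewrite ij => /eqP <-; rewrite permM;
    exact: (inj_eq (@perm_inj _ _)).
apply/forallP/forallP => [H x|H i]; apply/implyP.
  by case/imsetP => i; rewrite !inE => ij ->; have := H i; rewrite ij E.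
move=> ij; rewrite E //; have /implyP := H (a i); apply; apply/imsetP.
by exists i; rewrite ?inE.
Qed.

(** In the vanishing sum of [mcoef_sum0] all values [y] outside the images of [a]
    and of the rest of [b] give the same term [mcoef a b], because a transposition
    that moves none of the other letters exchanges them; there are at
    least [n - 2 * d] of them. The values already taken by [b] give zero. So
    [mcoef a b] is controlled by the remaining values, which lie in the image of
    [a]. *)
Lemma mcoef_step a b j : injective a -> injective b -> b j \notin codom a ->
  (n - 2 * d)%:R * `|mcoef a b| <= \sum_l `|mcoef a (update b j (a l))|.
Proof.
move=> aI bI bja.
pose A := a @: [set: 'I_d]; pose B := b @: [set~ j]; pose G := ~: (A :|: B).
have Ap y : (y \in A) = (y \in codom a).
  by apply/imsetP/codomP => -[i] => [_ ->|->]; exists i.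
have cG : (n - 2 * d <= #|G|)%N.
  rewrite -[X in (X - _)%N](card_ord n) -(cardsC (A :|: B)) -/G leq_subLR leq_add2r.
  apply: leq_trans (leq_card_setU _ _) _.
  rewrite !card_imset // cardsT cardsC1 card_ord; lia.
have MG y : y \in G -> mcoef a (update b j y) = mcoef a b.
  rewrite !inE negb_or => /andP[yA yB].
  rewrite -(mcoef_conj (tperm y (b j)) a b); congr mcoef; apply/ffunP => i;
    rewrite !ffunE.
    symmetry; apply: tpermD; first by apply: contraNneq yA => ->; rewrite Ap codom_f.
    by apply: contraNneq bja => ->; apply: codom_f.
  have [->|ij] := eqVneq i j; first by rewrite tpermR.
  rewrite tpermD //; last by rewrite (inj_eq bI) eq_sym.
  by apply: contraNneq yB => ->; apply/imsetP; exists i; rewrite ?inE.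
have := mcoef_sum0 b j aI; rewrite (bigID (mem G)) /= (eq_bigr _ MG) sumr_const.
move/eqP; rewrite addr_eq0 => /eqP e.
have -> : (n - 2 * d)%:R * `|mcoef a b| <= \sum_l `|mcoef a (update b j (a l))| =
  ((n - 2 * d)%:R * `|mcoef a b| <= \sum_(y in A) `|mcoef a (update b j y)|).
  rewrite /A big_imset /=; last by move=> i k _ _; apply: aI.
  by congr (_ <= _); apply: eq_bigl => i; rewrite inE.
apply: (@le_trans _ _ (`|mcoef a b *+ #|G| |)).
  by rewrite normrMn -[leRHS]mulr_natl ler_wpM2r ?ler_nat.
rewrite e normrN; apply: le_trans (ler_norm_sum _ _ _) _.
rewrite [leRHS](bigID (fun y => y \in B)) /=.
rewrite big_mkcond [X in _ <= _ + X]big_mkcond -[leLHS]add0r; apply: lerD.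
  by apply: sumr_ge0.
apply: ler_sum => y _; rewrite !inE negbK; case yA: (y \in A) => /=.
  case yB: (y \in B) => //=; rewrite mcoef_noninj ?normr0 //.
  case/imsetP: yB => i; rewrite !inE => ij ->; apply/injectiveP => /(_ i j).
  by rewrite !ffunE eqxx (negbTE ij) => /(_ erefl) /eqP; rewrite (negbTE ij).
case yB: (y \in B) => //=; rewrite mcoef_noninj ?normr0 //.
case/imsetP: yB => i; rewrite !inE => ij ->; apply/injectiveP => /(_ i j).
by rewrite !ffunE eqxx (negbTE ij) => /(_ erefl) /eqP; rewrite (negbTE ij).
Qed.

Definition precomp a (t : 'S_d) : {ffun 'I_d -> 'I_n} := [ffun i => a (t i)].

(** [t] completes the partial permutation [a i |-> b i] of the image of [a]. *)
Definition compat a b (t : 'S_d) := [forall i, (b i \in codom a) ==> (b i == a (t i))].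

(** Each application of [mcoef_step] joins the end of a path of the partial
    permutation [a i |-> b i] to one of the letters of [a]. The choices made
    on the way are recorded by [t], so that no completion occurs twice. *)
Lemma mcoef_close a b : injective a ->
  (n - 2 * d)%:R ^+ #|[pred i | b i \notin codom a]| * `|mcoef a b|
   <= \sum_(t | compat a b t) `|mcoef a (precomp a t)|.
Proof.
move=> aI; move Er: #|_| => r; elim: r b Er => [|r IH] b Er.
  have ba i : b i \in codom a.
    by apply: contraT => bi; have /card0_eq/(_ i) := Er; rewrite !inE bi.
  rewrite expr0 mul1r.
  have [/injectiveP bI|nb] := boolP (injectiveb b); last first.
    by rewrite mcoef_noninj // normr0 sumr_ge0.
  pose t0 i := iinv (ba i).
  have t0E i : a (t0 i) = b i by apply: f_iinv.
  have t0I : injective t0 by move=> i j e; apply: bI; rewrite -!t0E e.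
  rewrite (bigD1 (perm t0I)) /=; last first.
    by apply/forallP => i; rewrite permE t0E eqxx implybT.
  have -> : precomp a (perm t0I) = b by apply/ffunP => i; rewrite ffunE permE t0E.
  by rewrite lerDl sumr_ge0.
have [/injectiveP bI|nb] := boolP (injectiveb b); last first.
  by rewrite mcoef_noninj // normr0 mulr0 sumr_ge0.
have [j bj] : exists j, b j \notin codom a.
  have : (0 < #|[pred i | b i \notin codom a]|)%N by rewrite Er.
  by case/card_gt0P => j; rewrite inE; exists j.
rewrite exprS -mulrA mulrCA.
apply: le_trans (ler_wpM2l _ (mcoef_step aI bI bj)) _; first exact: exprn_ge0.
rewrite mulr_sumr (partition_big (fun t : 'S_d => t j) xpredT) //=.
apply: ler_sum => l _; apply: le_trans (IH _ _) _.
  move: Er; rewrite (cardD1 j) inE bj add1n => -[<-]; apply: eq_card => i.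
  by rewrite !inE ffunE; case: eqP => //=; rewrite codom_f.
rewrite le_eqVlt; apply/orP; left; apply/eqP; apply: eq_bigl => t.
apply/forallP/andP => [H|[/forallP H /eqP tl] i].
  split; last first.
    by have := H j; rewrite ffunE eqxx codom_f /= (inj_eq aI) eq_sym.
  apply/forallP => i; have := H i; rewrite ffunE; case: eqP => // -> _.
  by rewrite (negbTE bj).
by rewrite ffunE; case: eqP => [->|_ //]; rewrite tl eqxx implybT.
Qed.

End MatrixCoefficients.

(** * Schur's lemma and positivity *)

Section Parseval.
Variables (n d : nat) (f : 'S_n -> algC).
Implicit Types (a b : {ffun 'I_d -> 'I_n}).

Hypothesis fC : forall s t, f (s * t)%g = f (t * s)%g.
Hypothesis fS : forall phi : 'S_n -> algC,
  (forall s t, phi (s * t)%g = phi (t * s)%g) ->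
  forall y, f 1%g * \sum_x phi x * f (x * y)%g = (\sum_x phi x * f x) * f y.
Hypothesis fN : \sum_x `|f x| ^+ 2 = n`!%:R.
Hypothesis f1 : 0 < f 1%g.

(** By [fS] for the class function conjugate to [f], the inner product of two
    translates of [f] is again a value of [f]. *)
Lemma parseval (I J : finType) (P : pred I) (Q : pred J)
    (s : I -> 'S_n) (t : J -> 'S_n) :
  f 1%g * (\sum_x (\sum_(i | P i) f (x * s i)%g) * (\sum_(j | Q j) f (x * t j)%g)^*)
  = n`!%:R * \sum_(i | P i) \sum_(j | Q j) f ((t j)^-1 * s i)%g.
Proof.
have E u v : f 1%g * (\sum_x f (x * u)%g * (f (x * v)%g)^*) = n`!%:R * f (v^-1 * u)%g.
  rewrite (reindex_inj (mulIg v^-1%g)) /=.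
  have fcE : \sum_x (f x)^* * f x = n`!%:R.
    by rewrite -fN; apply: eq_bigr => x _; rewrite normCK mulrC.
  rewrite -fcE -(@fS (fun x => (f x)^*)) => [|s' t']; last by rewrite fC.
  by congr (_ * _); apply: eq_bigr => x _; rewrite mulgKV mulgA mulrC.
rewrite mulr_sumr.
under eq_bigr => x _ do rewrite rmorph_sum /= big_distrlr /= mulr_sumr.
rewrite exchange_big mulr_sumr /=; apply: eq_bigr => i _.
under eq_bigr => x _ do rewrite mulr_sumr.
rewrite exchange_big mulr_sumr /=; apply: eq_bigr => j _.
by rewrite -mulr_sumr E.
Qed.

Definition stab a := [pred h : 'S_n | [forall i, h (a i) == a i]].

Lemma stabP a (h : 'S_n) : reflect (forall i, h (a i) = a i) (stab a h).
Proof. by apply: (iffP forallP) => H i; apply/eqP; rewrite H. Qed.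

Lemma card_stab a : injective a -> #|stab a| = (n - d)`!.
Proof.
move=> aI; pose A := a @: [set: 'I_d].
have -> : #|stab a| = #|perm_on (~: A)|.
  apply: eq_card => h; rewrite !inE; apply/forallP/subsetP => [H x|H i].
    by rewrite !inE; apply: contraNN => /imsetP[i _ ->].
  have := H (a i); rewrite !inE; case: eqP => // _ /(_ isT) /negP[].
  by apply/imsetP; exists i.
rewrite card_perm; congr (_`!).
by rewrite -[X in (X - _)%N](card_ord n) -(cardsC A) card_imset // cardsT card_ord
  addKn.
Qed.

Local Notation app g a := ([ffun i => (g : 'S_n) (a i)] : {ffun 'I_d -> 'I_n}).

Lemma mcoef_coset g a (F : 'S_n -> algC) :
  \sum_(s : 'S_n | [forall i, s (a i) == app g a i]) F s = \sum_(h | stab a h) F (h *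
    g)%g.
Proof.
rewrite (reindex_inj (mulIg g)) /=; apply: eq_bigl => h; apply: eq_forallb => i.
by rewrite ffunE permM (inj_eq (@perm_inj _ g)).
Qed.

Lemma mcoef_stab a : mcoef f a a = \sum_(h | stab a h) f h.
Proof. by []. Qed.

Lemma stab_app a g : injective a -> injective (app g a).
Proof. by move=> aI i j; rewrite !ffunE => /perm_inj /aI. Qed.

Lemma mcoef_app a g : mcoef f a (app g a) = \sum_(h | stab a h) f (g * h)%g.
Proof. by rewrite /mcoef mcoef_coset; apply: eq_bigr => h _; rewrite fC. Qed.

Lemma mcoef_appM a g x : mcoef f a (app (g * x)%g a) = \sum_(h | stab a h) f (x * (h *
  g))%g.
Proof. rewrite mcoef_app; apply: eq_bigr => h _. by rewrite -mulgA [LHS]fC mulgA. Qed.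

Lemma stab_groupM a (h k : 'S_n) : stab a k -> stab a (k * h)%g = stab a h.
Proof.
move=> /stabP H; apply: eq_forallb => i; by rewrite permM H.
Qed.

Lemma stabV a (h : 'S_n) : stab a h^-1%g = stab a h.
Proof.
apply/stabP/stabP => H i; first by rewrite -{1}(H i) permKV.
by rewrite -{1}(H i) permK.
Qed.

Lemma stab_diff a (F : 'S_n -> algC) : injective a ->
  \sum_(h | stab a h) \sum_(k | stab a k) F (k^-1 * h)%g =
  (n - d)`!%:R * \sum_(h | stab a h) F h.
Proof.
move=> aI; rewrite exchange_big /= (eq_bigr (fun=> \sum_(h | stab a h) F h)) => [|k ka].
  by rewrite sumr_const card_stab // mulr_natl.
rewrite (reindex_inj (mulgI k)) /=; apply: eq_big => [h|h _]; first exact: stab_groupM.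
by rewrite mulKg.
Qed.

(** [parseval] for the translates of [f] by the cosets of the stabilizer of [a]; the
    double sum over the stabilizer collapses to a single one. *)
Lemma mcoef_polar a g : injective a ->
  f 1%g * (\sum_x mcoef f a (app (g * x)%g a) * (mcoef f a (app x a))^*)
   = n`!%:R * ((n - d)`!%:R * mcoef f a (app g a)).
Proof.
move=> aI; have := parseval (stab a) (stab a) (fun h => h * g)%g id.
under eq_bigr => x _ do rewrite -mcoef_appM -mcoef_app.
move=> ->; congr (_ * _).
under eq_bigr => h _ do under eq_bigr => k _ do rewrite mulgA.
by rewrite (stab_diff (fun h => f (h * g)%g)) // mcoef_app;
  under [in RHS]eq_bigr => h _ do rewrite fC.
Qed.

Lemma mcoef_norm2 a : injective a ->
  f 1%g * (\sum_x `|mcoef f a (app x a)| ^+ 2) = n`!%:R * ((n - d)`!%:R * mcoef f a a).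
Proof.
move=> aI; have := mcoef_polar 1%g aI.
have -> : app (1%g : 'S_n) a = a by apply/ffunP => i; rewrite ffunE perm1.
move=> <-; congr (_ * _); apply: eq_bigr => x _; rewrite mul1g; exact: normCK.
Qed.

Lemma mcoef_ge0 a : injective a -> 0 <= mcoef f a a.
Proof.
move=> aI; have : 0 <= n`!%:R * ((n - d)`!%:R * mcoef f a a).
  rewrite -mcoef_norm2 //; apply: mulr_ge0; first exact: ltW.
  by apply: sumr_ge0 => x _; apply: exprn_ge0.
by rewrite !pmulr_rge0 // ltr0n fact_gt0.
Qed.

(** Both factors in [mcoef_polar] have the same square sum, which [mcoef_norm2]
    computes. *)
Lemma mcoef_le a g : injective a -> `|mcoef f a (app g a)| <= mcoef f a a.
Proof.
move=> aI.
rewrite -(ler_pM2l (x := (n - d)`!%:R)) ?ltr0n ?fact_gt0 //.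
rewrite -(ler_pM2l (x := n`!%:R)) ?ltr0n ?fact_gt0 //.
have -> : n`!%:R * ((n - d)`!%:R * `|mcoef f a (app g a)|) =
   `|n`!%:R * ((n - d)`!%:R * mcoef f a (app g a))| by rewrite !normrM !normr_nat.
rewrite -mcoef_polar // normrM gtr0_norm //.
have E : \sum_x `|mcoef f a (app (g * x)%g a)| ^+ 2 = \sum_x `|mcoef f a (app x a)| ^+
  2.
  by rewrite [RHS](reindex_inj (mulgI g)).
rewrite -mcoef_norm2 // ler_pM2l //.
apply: le_trans (ler_norm_sum _ _ _) _.
apply: (@le_trans _ _ (\sum_x (`|mcoef f a (app (g * x)%g a)| ^+ 2 + `|mcoef f a (app
  x a)| ^+ 2) / 2)).
  apply: ler_sum => x _; rewrite normrM norm_conjC ler_pdivlMr ?ltr0n //.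
  set u := `|_|; set v := `|_|.
  rewrite -subr_ge0; have -> : u ^+ 2 + v ^+ 2 - u * v * 2 = (u - v) ^+ 2 by ring.
  by rewrite -realEsqr rpredB // ger0_real // normr_ge0.
by rewrite -mulr_suml big_split /= E mulrDl -splitr.
Qed.

(** In [mcoef_norm2] keep only the [x] with [x o a = a o t] for some [t]; there are
    (n - d)! of them for each [t]. *)
Lemma mcoef_sum2 a : injective a ->
  f 1%g * (\sum_(t : 'S_d) `|mcoef f a (precomp a t)| ^+ 2) <= n`!%:R * mcoef f a a.
Proof.
move=> aI; rewrite -(ler_pM2l (x := (n - d)`!%:R)) ?ltr0n ?fact_gt0 //.
rewrite [leRHS]mulrCA -mcoef_norm2 // mulrCA ler_pM2l //.
pose P (t : 'S_d) := [pred x : 'S_n | app x a == precomp a t].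
have pI t : injective (precomp a t) by move=> i j; rewrite !ffunE => /aI /perm_inj.
have cP t : (n - d)`!%:R = \sum_(x | P t x) (1 : algC).
  have [g /= eg] := inj_extend aI (pI t).
  rewrite (eq_bigl (fun x : 'S_n => [forall i, x (a i) == app g a i])).
    by rewrite mcoef_coset sumr_const card_stab.
  move=> x /=; apply/eqP/forallP => [/ffunP H i|H].
    by have := H i; rewrite !ffunE => ->; rewrite -eg ffunE.
  by apply/ffunP => i; rewrite eg ffunE; have := H i; rewrite ffunE => /eqP.
rewrite mulr_sumr.
rewrite (eq_bigr (fun t => \sum_(x | P t x) `|mcoef f a (app x a)| ^+ 2)); last first.
  by move=> t _; rewrite (cP t) mulr_suml; apply: eq_bigr => x /eqP ->; rewrite mul1r.
rewrite (exchange_big_dep xpredT) //=; apply: ler_sum => x _.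
have [t0 /= e0|no] := pickP (fun t => P t x); last by rewrite big_pred0 // exprn_ge0.
rewrite (bigD1 t0) // big_pred0 /= ?addr0 // => t.
apply/negP => /andP[/eqP e1 /negP[]]; apply/eqP/permP => i; apply: aI.
by move/eqP: e0; rewrite e1 => /ffunP/(_ i); rewrite !ffunE.
Qed.

Definition injections := [pred a : {ffun 'I_d -> 'I_n} | injectiveb a].

(** [fS] for the class function that counts the injections fixed by a permutation. *)
Lemma mcoef_expand a y : injective a ->
  f 1%g * (\sum_(b in injections) mcoef f b (app y b)) =
  (#|injections|%:R * mcoef f a a) * f y.
Proof.
move=> aI.
pose phi (x : 'S_n) : algC := \sum_(b in injections) (stab b x)%:R.
have phiC s t : phi (s * t)%g = phi (t * s)%g.
  rewrite /phi [RHS](reindex_inj (h := fun b => app s b)) /=.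
    apply: eq_big => [b|b _].
      rewrite !inE; apply/injectiveP/injectiveP => bI; first exact: stab_app.
      by move=> i j e; apply: bI; rewrite !ffunE e.
    congr (_%:R); congr nat_of_bool; apply: eq_forallb => i.
    by rewrite !ffunE !permM (inj_eq (@perm_inj _ s)).
  by move=> b c /ffunP e; apply/ffunP => i; have := e i; rewrite !ffunE => /perm_inj.
have phiE z : \sum_x phi x * f (x * z)%g = \sum_(b in injections) mcoef f b (app z b).
  under eq_bigr => x _ do rewrite mulr_suml.
  rewrite exchange_big /=; apply: eq_bigr => b _.
  rewrite /mcoef mcoef_coset [RHS]big_mkcond; apply: eq_bigr => x _.
  by rewrite /=; case: [forall i, x (b i) == b i]; rewrite ?mul1r ?mul0r.
have := fS phiC y; rewrite phiE => ->; congr (_ * _).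
have := phiE 1%g; under eq_bigr => x _ do rewrite mulg1.
move=> ->; rewrite mulr_natl -sumr_const; apply: eq_bigr => b;
  rewrite inE => /injectiveP bI.
have [g /= eg] := inj_extend aI bI.
have eb : b = app g a by apply/ffunP => i; rewrite ffunE.
have -> : app (1%g : 'S_n) b = b by apply/ffunP => i; rewrite ffunE perm1.
by rewrite eb mcoef_conj.
Qed.

(** Sum [mcoef_expand] over the stabilizer of [a]. Each [b] contributes a nonnegative
    amount, because [f] is positive definite, and each of the d! rearrangements of
    [a] contributes (n - d)! times [mcoef f a a]. *)
Lemma mcoef_injections_ge a : injective a -> mcoef f a a != 0 ->
  (d`! * (n - d)`!)%:R * f 1%g <= #|injections|%:R * mcoef f a a.
Proof.
move=> aI m0; have mp : 0 < mcoef f a a by rewrite lt_def m0 mcoef_ge0.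
rewrite -(ler_pM2r mp).
have <- : f 1%g * (\sum_(y | stab a y) \sum_(b in injections) mcoef f b (app y b)) =
    #|injections|%:R * mcoef f a a * mcoef f a a.
  rewrite mulr_sumr mcoef_stab [RHS]mulr_sumr; apply: eq_bigr => y _;
    exact: mcoef_expand.
rewrite exchange_big /= [X in X * _]mulrC -mulrA ler_pM2l //.
have pos b : b \in injections -> 0 <= \sum_(y | stab a y) mcoef f b (app y b).
  rewrite inE => /injectiveP bI.
  have E : \sum_(y | stab a y) mcoef f b (app y b) = \sum_(h | stab b h) \sum_(y |
    stab a y) f (h * y)%g.
    rewrite exchange_big /=; apply: eq_bigr => y _; rewrite mcoef_app.
    by apply: eq_bigr => h _; rewrite fC.
  pose P := [pred z : 'S_n * 'S_n | stab b z.1 && stab a z.2].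
  (* Up to a factor the sum is the square norm of the sum of the translates of
     f by the products of an element of [stab b] and one of [stab a]. *)
  have := parseval P P (fun z => z.1 * z.2)%g (fun z => z.1 * z.2)%g.
  set X := (X in _ = _ * X).
  have -> : X = (n - d)`!%:R * ((n - d)`!%:R * \sum_(y | stab a y) mcoef f b (app y b)).
    rewrite /X (eq_bigr (fun z => \sum_(h | stab b h) \sum_(y | stab a y) f (h^-1 *
      z.1 * (z.2 * y^-1))%g)); last first.
      move=> z _; rewrite pair_big /=; apply: eq_bigr => u _.
      by rewrite invMg -!mulgA fC !mulgA.
    rewrite -(pair_big (stab b) (stab a) (fun z1 z2 => \sum_(h | stab b h) \sum_(y |
      stab a y) f (h^-1 * z1 * (z2 * y^-1))%g)) /=.
    under eq_bigr => z1 _ do rewrite exchange_big /=.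
    rewrite (stab_diff (fun x => \sum_(z2 | stab a z2) \sum_(y | stab a y) f (x * (z2
      * y^-1))%g)) //.
    congr (_ * _); rewrite E mulr_sumr; apply: eq_bigr => h _.
    rewrite -stab_diff //.
    rewrite exchange_big (reindex_inj invg_inj) /=; apply: eq_big => [y|y _];
      first exact: stabV.
    rewrite (reindex_inj invg_inj) /=; apply: eq_big => [z|z _]; first exact: stabV.
    by rewrite invgK.
  move=> e; have : 0 <= n`!%:R * ((n - d)`!%:R * ((n - d)`!%:R * \sum_(y | stab a y)
    mcoef f b (app y b))).
    rewrite -e; apply: mulr_ge0; first exact: ltW.
    by apply: sumr_ge0 => x _; apply: mul_conjC_ge0.
  by rewrite !pmulr_rge0 // ltr0n fact_gt0.
have imI : injective (fun t : 'S_d => precomp a t).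
  by move=> t u /ffunP e; apply/permP => i; apply: aI; have := e i; rewrite !ffunE.
rewrite [leRHS](bigID (mem [set precomp a t | t in [set: 'S_d]])) /= -[leLHS]addr0;
  apply: lerD; last first.
  by apply: sumr_ge0 => b /andP[bi _]; apply: pos.
rewrite (eq_bigl (mem [set precomp a t | t in [set: 'S_d]])); last first.
  move=> b /=; rewrite andbC; case: imsetP => //= -[t _ ->]; rewrite inE.
  by apply/injectiveP => i j; rewrite !ffunE => /aI /perm_inj.
rewrite big_imset /=; last by move=> t u _ _; apply: imI.
rewrite (eq_bigr (fun=> (n - d)`!%:R * mcoef f a a)).
  rewrite (eq_bigl xpredT) ?sumr_const ?card_Sn; last by move=> t; rewrite inE.
  by rewrite natrM -mulrA [leLHS]mulr_natl lexx.
move=> t _; rewrite -(card_stab aI) mulr_natl -sumr_const;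
  apply: eq_bigr => y /stabP ya.
have st (s : 'S_n) : [forall i, s (precomp a t i) == app y (precomp a t) i] = stab a s.
  apply/forallP/stabP => H i.
    by have /eqP := H (t^-1 i)%g; rewrite !ffunE permKV ya.
  by rewrite !ffunE H ya.
by rewrite /mcoef (eq_bigl _ _ st).
Qed.

End Parseval.

(** * A pointwise bound by intertwining pairs *)

Section CloseCount.
Variables (n d : nat) (s : 'S_n) (t : 'S_d) (I : {set 'I_d}).

(** The injection [a] intertwines [s] and [t] on the cycles of [t] contained in [I].
    From any other index one leaves [I] after finitely many steps of [t], and the
    value of [a] there is carried back by [s]. So [a] is determined by its
    restrictions to these cycles and to the complement of [I]. *)
Lemma card_partial_intertwines :
  (#|[pred a : {ffun 'I_d -> 'I_n} |
       injectiveb a && [forall i in I, s (a i) == a (t i)]]|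
   <= n ^ #|~: I| * #|[pred p | pinj p && intertwines s t p]|)%N.
Proof.
pose some := [pred o : option 'I_n | isSome o].
have csome : #|some| = n.
  transitivity #|[set Some y | y : 'I_n]|; last first.
    by rewrite card_imset ?card_ord //; apply: Some_inj.
  apply: eq_card => -[y|].
    by rewrite !inE; symmetry; apply/imsetP; exists y.
  by rewrite !inE; symmetry; apply/negbTE/imsetP => -[].
pose rst (a : {ffun 'I_d -> 'I_n}) : {ffun 'I_d -> option 'I_n} :=
  [ffun i => if i \in I then None else Some (a i)].
pose cyc (a : {ffun 'I_d -> 'I_n}) : {ffun 'I_d -> option 'I_n} :=
  [ffun i => if porbit t i \subset I then Some (a i) else None].
have -> : (n ^ #|~: I|)%N = #|pffun_on None (mem (~: I)) some| by rewrite
  card_pffun_on csome.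
rewrite -cardX.
rewrite -(@card_in_imset _ _ (fun a => (rst a, cyc a))).
  apply: subset_leq_card; apply/subsetP => z /imsetP[a ga ->]; move: ga.
  rewrite inE => /andP[/injectiveP aI /forall_inP H]; rewrite !inE /=; apply/and3P;
    split.
  - apply/pffun_onP; split.
      by apply/subsetP => i; rewrite !inE ffunE; case: (i \in I).
    by move=> o /imageP[i iI ->]; move: iI; rewrite !inE ffunE => /negbTE ->.
  - apply/pinjP => i j y; rewrite !ffunE; case: ifP => // _ [<-];
    case: ifP => // _ [] /aI; exact/esym.
  apply/forallP => i; rewrite !ffunE.
  have -> : porbit t (t i) = porbit t i by have := porbit_perm t 1 i; rewrite expg1.
  case: ifP => //= /subsetP sI; apply/eqP; congr Some; apply/eqP/H/sI; exact: porbit_id.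
move=> a b; rewrite !inE => /andP[_ /forall_inP Ha] /andP[_ /forall_inP Hb] [/ffunP er
  /ffunP ec].
have out k : forall i, (t ^+ k)%g i \notin I -> a i = b i.
  elim: k => [|k IH] i.
    by rewrite expg0 perm1 => /negbTE iI; have := er i; rewrite !ffunE iI => -[].
  rewrite expgS permM; case iI: (i \in I); last by have := er i;
    rewrite !ffunE iI => -[->].
  by move=> /IH e; apply: (@perm_inj _ s); rewrite (eqP (Ha i iI)) (eqP (Hb i iI)).
apply/ffunP => i; have := ec i; rewrite !ffunE;
  case: ifP => [_ []//|/negbT /subsetPn[j /porbitP[k ->]]].
by move=> /out.
Qed.

End CloseCount.

Lemma sum_subset_exp (d : nat) (R : comNzRingType) (x y : R) :
  (\sum_(I : {set 'I_d}) x ^+ #|I| * y ^+ #|~: I| = (x + y) ^+ d)%R.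
Proof.
rewrite -[in RHS](card_ord d) -prodr_const bigA_distr; apply: eq_bigr => I _.
rewrite (bigID (mem I)) /=; congr (_ * _).
  by rewrite -prodr_const; apply: eq_bigr => i ->.
rewrite -prodr_const.  rewrite (eq_bigl (fun i => i \notin I)) => [|i];
  last by rewrite !inE.
apply: eq_bigr => i iI; case: ifP => // H; by rewrite H in iI.
Qed.

Section Pointwise.
Variables (n d : nat) (f : 'S_n -> algC).
Implicit Types (a b : {ffun 'I_d -> 'I_n}).

Hypothesis fC : forall s t, f (s * t)%g = f (t * s)%g.
Hypothesis fS : forall phi : 'S_n -> algC,
  (forall s t, phi (s * t)%g = phi (t * s)%g) ->
  forall y, f 1%g * \sum_x phi x * f (x * y)%g = (\sum_x phi x * f x) * f y.
Hypothesis fN : \sum_x `|f x| ^+ 2 = n`!%:R.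
Hypothesis f1 : 0 < f 1%g.
Hypothesis fV : forall (B : {set 'I_n}) g, (#|B| < d)%N ->
  \sum_(h : 'S_n | [forall x in B, h x == x]) f (h * g)%g = 0.

Lemma mcoef_precomp a b t : injective a -> injective b ->
  mcoef f b (precomp b t) = mcoef f a (precomp a t).
Proof.
move=> aI bI; have [g eg] := inj_extend aI bI.
rewrite -(mcoef_conj fC g a); congr mcoef; apply/ffunP => i; by rewrite !ffunE eg.
Qed.

(** Expand [f y] by [mcoef_expand] and complete each term by [mcoef_close]. For a
    given completion [t] let [I] be the set where [y o a = a o t]; then the weight
    is [(n - 2 d) ^ (- #|~: I|)], while by [card_partial_intertwines] there are at most
    [n ^ #|~: I|] injections [a] for each intertwining partial injection. Summed
    over all [I], the ratio is [(1 + n / (n - 2 d)) ^ d], at most [4 ^ d]. *)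
Lemma pointwise_bound a y : injective a -> (0 < n)%N -> (n <= 3 * (n - 2 * d))%N ->
  #|injections n d|%:R * mcoef f a a * `|f y| <=
  f 1%g * 4 ^+ d * \sum_t `|mcoef f a (precomp a t)| *
     #|[pred p | pinj p && intertwines y t p]|%:R.
Proof.
move=> aI n0 n3.
have N0 : 0 < (n - 2 * d)%:R :> algC by rewrite ltr0n; lia.
pose N : algC := (n - 2 * d)%:R.
rewrite -(ler_pM2r (exprn_gt0 d N0)) -/N.
have -> : #|injections n d|%:R * mcoef f a a * `|f y| = `|f 1%g * \sum_(b in
  injections n d) mcoef f b [ffun i => y (b i)]|.
  by rewrite (mcoef_expand fC fS y aI) normrM normrM normr_nat (ger0_norm (mcoef_ge0
    fC fS fN f1 aI)).
rewrite normrM gtr0_norm // -!mulrA ler_pM2l //.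
apply: (@le_trans _ _ (\sum_(b in injections n d) N ^+ d * `|mcoef f b [ffun i => y (b
  i)]|)).
  rewrite -mulr_sumr mulrC ler_wpM2l ?ler_norm_sum //; exact/exprn_ge0/ltW.
pose m (t : 'S_d) := `|mcoef f a (precomp a t)|.
have m0 t : 0 <= m t by apply: normr_ge0.
pose C (b : {ffun 'I_d -> 'I_n}) (t : 'S_d) (I : {set 'I_d}) := [forall i in I, y (b
  i) == b (t i)].
have step b : b \in injections n d -> N ^+ d * `|mcoef f b [ffun i => y (b i)]| <=
   \sum_t m t * \sum_(I | C b t I) N ^+ #|I|.
  rewrite inE => /injectiveP bI; set c := finfun _.
  pose I := [set i | c i \in codom b].
  have -> : N ^+ d = N ^+ #|I| * N ^+ #|[pred i | c i \notin codom b]|.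
    rewrite -exprD -[in LHS](card_ord d) -(cardsC I); congr (_ ^+ (_ + _)).
    by apply: eq_card => i; rewrite !inE.
  rewrite -mulrA; apply: le_trans (ler_wpM2l _ (mcoef_close fC fV c bI)) _;
    first exact/exprn_ge0/ltW.
  rewrite mulr_sumr big_mkcond; apply: ler_sum => t _.
  have P0 : 0 <= m t * \sum_(I | C b t I) N ^+ #|I|.
    apply: mulr_ge0; first exact: normr_ge0. apply: sumr_ge0 => J _;
      exact/exprn_ge0/ltW.
  case: ifP => // /forallP ct; rewrite (mcoef_precomp t aI bI) -/(m t) [leLHS]mulrC;
    apply: (ler_wpM2l (m0 t)).
  rewrite (bigD1 I) /=; last first.
    by apply/forall_inP => i; rewrite inE => ci; have := ct i; rewrite ci ffunE.
  by rewrite lerDl; apply: sumr_ge0 => J _; exact/exprn_ge0/ltW.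
apply: le_trans (ler_sum _ step) _.
rewrite exchange_big /= mulr_suml mulr_sumr; apply: ler_sum => t _.
rewrite -mulr_sumr -/(m t).
have -> (u v : algC) : 4 ^+ d * (m t * u * v) = m t * (4 ^+ d * v * u) by ring.
apply: (ler_wpM2l (m0 t)).
set pc := #|_|.
apply: (@le_trans _ _ (\sum_(I : {set 'I_d}) N ^+ #|I| * (n ^ #|~: I| * pc)%:R)).
  rewrite (exchange_big_dep xpredT) //=; apply: ler_sum => I _.
  rewrite sumr_const -[leLHS]mulr_natr ler_wpM2l //; first exact/exprn_ge0/ltW.
  rewrite ler_nat; apply: leq_trans (card_partial_intertwines y t I).
  by apply: subset_leq_card; apply/subsetP => b; rewrite !inE.
under eq_bigr => I _ do rewrite natrM natrX mulrA.
rewrite -mulr_suml sum_subset_exp; apply: ler_wpM2r => //.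
rewrite -exprMn; apply: lerXn2r; rewrite ?nnegrE /N -?natrM -?natrD ?ler0n // ler_nat;
  lia.
Qed.

End Pointwise.

(** * Modules generated by an element of the group algebra *)

Section IrrSchur.
Variables (gT : finGroupType) (G : {group gT}).

(** A central element acts by a scalar on an irreducible module. Here this comes from
    expanding the class function [x |-> phi x^-1] in irreducible characters and
    from the generalized orthogonality relation. *)
Lemma irr_schur (chi : 'CF(G)) (phi : gT -> algC) : chi \in irr G ->
  {in G &, forall x y, phi (x * y)%g = phi (y * x)%g} ->
  {in G, forall y, chi 1%g * (\sum_(x in G) phi x * chi (x * y)%g) =
                   (\sum_(x in G) phi x * chi x) * chi y}.
Proof.
case/irrP=> i -> phiC.
(* The orthogonality relation pairs a character at x y with one at x^-1. *)
pose psi x := if x \in G then phi x^-1%g else 0.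
have psiP : is_class_fun <<G>>%g (finfun psi).
  rewrite genGid; apply: intro_class_fun => [x y Gx Gy|x /negbTE nx];
    last by rewrite /psi nx.
  by rewrite /psi groupJr // Gx conjgE !invMg invgK phiC ?groupM ?groupV // mulKVg.
pose psif : 'CF(G) := Cfun 0 psiP.
have psiE x : x \in G -> psif x^-1%g = phi x.
  by move=> Gx; rewrite cfunE /psi groupV Gx invgK.
have G0 : #|G|%:R != 0 :> algC by rewrite pnatr_eq0 -lt0n cardG_gt0.
have E y : y \in G -> 'chi_i 1%g * (\sum_(x in G) phi x * 'chi_i (x * y)%g) =
    #|G|%:R * '[psif, 'chi_i] * 'chi_i y.
  move=> Gy; rewrite (eq_bigr (fun x => \sum_j '[psif, 'chi_j] * ('chi_i (x * y)%g *
    'chi_j x^-1%g))).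
    rewrite exchange_big /= (bigD1 i) //= [X in _ + X]big1 ?addr0 => [|j ji].
      rewrite -mulr_sumr; have := generalized_orthogonality_relation y i i.
      rewrite eqxx mul1r => /(congr1 (fun z => #|G|%:R * z));
        rewrite /= mulVKf // => ->.
      by field; apply: irr1_neq0.
    rewrite -mulr_sumr; have := generalized_orthogonality_relation y i j.
    rewrite eq_sym (negbTE ji) mul0r => /eqP; rewrite mulf_eq0 invr_eq0 (negbTE G0) /=.
    by move/eqP ->; rewrite mulr0.
  move=> x Gx; rewrite -psiE // {1}(cfun_sum_cfdot psif) sum_cfunE mulr_suml.
  by apply: eq_bigr => j _; rewrite cfunE mulrAC mulrA.
move=> y Gy; rewrite E //; congr (_ * _).
have := E 1%g (group1 G); under eq_bigr => x _ do rewrite mulg1.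
by rewrite [LHS]mulrC => /(mulIf (irr1_neq0 i)) ->.
Qed.

End IrrSchur.

Section CyclicModule.
Variables (gT : finGroupType) (G : {group gT}) (e : gT -> algC).
Local Notation aG := (regular_repr algC G).
Local Notation nG := #|pred_of_set (gval G)|.
Variable E : 'M[algC]_nG.
Hypothesis eE : E = \sum_(x in G) e x *: aG x.
Let U := cyclic_mx aG (gring_row E).
Let Umod : mxmodule aG U := cyclic_mx_module aG (gring_row E).
Let rho := submod_repr Umod.

Lemma gring_sumE (c : gT -> algC) : (\sum_(x in G) c x *: aG x \in
  enveloping_algebra_mx aG)%MS.
Proof. by apply/envelop_mxP; exists c. Qed.

Lemma gring_row_eq0 (A : 'M[algC]_nG) : (A \in enveloping_algebra_mx aG)%MS ->
  gring_row A = 0 -> A = 0.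
Proof. by move=> AE A0; rewrite -(gring_rowK AE) A0 linear0. Qed.

(** The module consists of the vectors E y, and an element of the group algebra acts
    on it by multiplication from the right. *)
Lemma cyclic_annihil (c : gT -> algC) :
  (forall y, y \in G -> E *m aG y *m (\sum_(x in G) c x *: aG x) = 0) <->
  \sum_(x in G) c x *: rho x = 0.
Proof.
set S := \sum_(x in G) c x *: aG x; set T := \sum_(x in G) c x *: rho x.
have valT m (W : 'M_(m, \rank U)) : val_submod (W *m T) = val_submod W *m S.
  rewrite /T /S !mulmx_sumr linear_sum /=; apply: eq_bigr => x Gx.
  by rewrite -!scalemxAr linearZ /= val_submodJ.
split=> [H|T0 y Gy].
  rewrite -[T]mul1mx; apply: (can_inj (@val_submodK _ _ U _)); rewrite valT linear0.
  apply/row_matrixP => i; rewrite row_mul row0.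
  have /cyclic_mxP[A /envelop_mxP[a ->] ->] : (row i (val_submod (1%:M : 'M_(\rank
    U))) <= U)%MS.
    by apply: submx_trans (row_sub _ _) (val_submodP _).
  rewrite [gring_row E *m _]mulmx_sumr mulmx_suml big1 // => y Gy.
  by rewrite -scalemxAr -scalemxAl -!gring_row_mul H // linear0 scaler0.
apply: gring_row_eq0.
  rewrite envelop_mxM ?gring_sumE // envelop_mxM ?envelop_mx_id // eE;
    exact: gring_sumE.
rewrite !gring_row_mul.
have vU : (gring_row E *m aG y <= U)%MS by rewrite mxmodule_trans ?cyclic_mx_id.
by rewrite -(in_submodK vU) -valT T0 mulmx0 linear0.
Qed.

(** In an irreducible representation over an algebraically closed field the group
    spans all matrices, so an operator whose products with the group have
    trace zero is zero. *)
Lemma irr_trace_eq0 (c : gT -> algC) : cfRepr rho \in irr G ->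
  (forall y, y \in G -> \sum_(x in G) c x * cfRepr rho (x * y)%g = 0) ->
  \sum_(x in G) c x *: rho x = 0.
Proof.
case/irr_reprP=> -[m rG] /= irrG chiE H.
have /mx_abs_irrP[m0 [a_ Ha]] := groupC irrG.
have simG : mx_rsim rho rG by apply: cfRepr_inj.
have T0 : \sum_(x in G) c x *: rG x = 0.
  set T := (X in X = _).
  have tr0 (A : 'M_m) : \tr (T *m A) = 0.
    rewrite (Ha A) mulmx_sumr linear_sum big1 //= => y Gy.
    rewrite -scalemxAr linearZ /= /T mulmx_suml linear_sum /=.
    have := H y Gy; rewrite chiE => Hy.
    rewrite (eq_bigr (fun x => c x * cfRepr rG (x * y)%g)) ?Hy ?mulr0 // => x Gx.
    by rewrite -scalemxAl linearZ /= cfunE groupM // mulr1n repr_mxM.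
  apply/matrixP => i j; rewrite [RHS]mxE.
  have := tr0 (delta_mx j i); rewrite /mxtrace (bigD1 i) //= big1 => [|k ki].
    rewrite addr0 mxE (bigD1 j) //= big1 => [|k kj];
      first by rewrite addr0 mxE !eqxx mulr1.
    by rewrite mxE (negbTE kj) mulr0.
  by rewrite mxE big1 // => l _; rewrite mxE (negbTE ki) andbF mulr0.
case: simG => B em Bf BE.
apply: (row_free_inj Bf); rewrite mul0mx mulmx_suml.
rewrite (eq_bigr (fun x => B *m (c x *: rG x))) => [|x Gx].
  by rewrite -mulmx_sumr T0 mulmx0.
by rewrite -scalemxAl BE // scalemxAr.
Qed.

Lemma real_gram_eq0 m p (A : 'M[algC]_(m, p)) :
  (forall i j, A i j \is Num.real) -> A *m A^T = 0 -> A = 0.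
Proof.
move=> Ar A0; apply/matrixP => i j; rewrite mxE.
have := congr1 (fun B : 'M_m => B i i) A0; rewrite !mxE => /eqP.
rewrite psumr_eq0 => [/allP/(_ j)|k _].
  by rewrite mem_index_enum mxE mulf_eq0 orbb => /(_ isT)/eqP.
by rewrite mxE -expr2 -realEsqr.
Qed.

Lemma regular_tr x : x \in G -> (aG x)^T = aG x^-1%g.
Proof.
move=> Gx; apply/matrixP => i j; rewrite !mxE.
congr (_%:R); congr nat_of_bool.
have Gi : enum_val i \in G := enum_valP i.
have Gj : enum_val j \in G := enum_valP j.
rewrite ?eqxx /=.
apply/eqP/eqP => [->|->].
  by rewrite gring_indexK ?groupM // mulgK /gring_index enum_valK_in.
by rewrite gring_indexK ?groupM ?groupV // mulgKV /gring_index enum_valK_in.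
Qed.

(** The transpose of [E] in the regular representation comes again from the group
    algebra, so E E^T E = 0. Hence the real symmetric matrix E E^T has
    square zero, which forces E E^T = 0 and E = 0. *)
Lemma right_ideal_square (er : forall x, e x \is Num.real) :
  (forall y, y \in G -> E *m aG y *m E = 0) -> E = 0.
Proof.
move=> H.
have Er i j : E i j \is Num.real.
  rewrite eE summxE rpred_sum // => x Gx; rewrite mxE rpredM // mxE mxE.
  exact: realn.
have ETE : E *m E^T *m E = 0.
  rewrite {2}eE linear_sum /= mulmx_sumr mulmx_suml big1 // => x Gx.
  by rewrite linearZ /= -scalemxAr -scalemxAl regular_tr // H ?groupV // scaler0.
apply: real_gram_eq0 => //; apply: real_gram_eq0 => [i j|].
  by rewrite mxE rpred_sum // => k _; rewrite rpredM // mxE.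
by rewrite trmx_mul trmxK mulmxA ETE mul0mx.
Qed.

End CyclicModule.

(** * Twisting an irreducible character by the sign *)

Section SignTwist.
Variables (n : nat) (e : bool).
Definition twist_sign (s : 'S_n) : algC := (-1) ^+ (e && odd_perm s).

Lemma twist_signM s t : twist_sign (s * t)%g = twist_sign s * twist_sign t.
Proof. by rewrite /twist_sign odd_permM; case: e; rewrite //= ?mulr1 // signr_addb. Qed.
Lemma twist_signV s : twist_sign s^-1%g = twist_sign s.
Proof. by rewrite /twist_sign odd_permV. Qed.

Lemma twist_sign1 : twist_sign 1%g = 1.
Proof. by rewrite /twist_sign odd_perm1 andbF. Qed.

Lemma twist_signK s : twist_sign s * twist_sign s = 1.
Proof. by rewrite -twist_signM -{2}(invgK s) twist_signM twist_signV -twist_signM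
  mulgV twist_sign1. Qed.

Lemma twist_sign_tperm u w : u != w -> twist_sign (tperm u w) = (-1) ^+ e.
Proof. by rewrite /twist_sign odd_tperm => ->; rewrite andbT. Qed.
Lemma norm_twist_sign s : `|twist_sign s| = 1.
Proof. by rewrite /twist_sign normr_sign. Qed.

Variable chi : 'CF(symg n).
Hypothesis irr_chi : chi \in irr (symg n).
Definition twist s := twist_sign s * chi s.

Lemma twistC s t : twist (s * t)%g = twist (t * s)%g.
Proof.
rewrite /twist !twist_signM [twist_sign s * _]mulrC; congr (_ * _).
by rewrite -[LHS](cfunJ chi _ (in_setT s)) conjgE -mulgA mulKg.
Qed.

Lemma twist1 : twist 1%g = chi 1%g.
Proof. by rewrite /twist twist_sign1 mul1r. Qed.

Lemma norm_twist s : `|twist s| = `|chi s|.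
Proof. by rewrite normrM norm_twist_sign mul1r. Qed.

Lemma twist_gt0 : 0 < twist 1%g.
Proof. by rewrite twist1; case/irrP: irr_chi => i ->; apply: irr1_gt0. Qed.

Lemma twist_schur (phi : 'S_n -> algC) : (forall s t, phi (s * t)%g = phi (t * s)%g) ->
  forall y, twist 1%g * (\sum_x phi x * twist (x * y)%g) = (\sum_x phi x * twist x) *
    twist y.
Proof.
move=> phiC y.
have := @irr_schur _ (symg n) chi (fun x => twist_sign x * phi x) irr_chi _ y.
rewrite inE => /(_ _ isT) H.
rewrite twist1 /twist [RHS]mulrCA.
have {}H := H (fun s t _ _ => _).
have -> : \sum_x phi x * (twist_sign x * chi x) = \sum_(x in symg n) twist_sign x *
  phi x * chi x.
  by apply: eq_big => [x|x _]; rewrite ?inE // mulrCA mulrA.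
rewrite -H => [|s t]; last by rewrite !twist_signM phiC [twist_sign s * _]mulrC.
rewrite mulrCA; congr (_ * _); rewrite mulr_sumr.
by apply: eq_big => [x|x _]; rewrite ?inE // twist_signM; ring.
Qed.

Lemma twist_norm2 : \sum_x `|twist x| ^+ 2 = n`!%:R.
Proof.
have := irrWnorm irr_chi;
  rewrite (cfnormE (cfun_onG chi)) => /(congr1 (fun z => #|symg n|%:R * z)).
have G0 : #|symg n|%:R != 0 :> algC by rewrite pnatr_eq0 -lt0n cardG_gt0.
rewrite /= mulVKf // mulr1 cardsT card_Sn => <-.
by apply: eq_big => [x|x _]; rewrite ?inE // norm_twist.
Qed.

End SignTwist.

(** * The Young symmetrizer and the level *)

Section YoungKill.
Variables (n : nat) (e : bool).
Local Notation aG := (regular_repr algC (symg n)).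

Lemma aGM s t : aG (s * t)%g = aG s *m aG t.
Proof. by rewrite repr_mxM ?inE. Qed.

Definition signed_sum (P : pred 'S_n) := \sum_(h | P h) twist_sign e h *: aG h.

(** Two letters [u] and [w] outside [X] have the same label after applying [y^-1],
    because there are fewer than [#|~: X|] labels. The transposition [(u w)]
    can be absorbed on the right of the product with the sign [(-1) ^+ e],
    and, moved across [y], on the left with the opposite sign. *)
Lemma pigeonhole_kill (M : 'M_#|symg n|) (lab : 'I_n -> nat) (k : nat)
    (X : {set 'I_n}) y :
  (forall i, (lab i < k)%N) ->
  (forall u w, u != w -> lab u = lab w -> M *m aG (tperm u w) = (-1) ^+ (~~ e) *: M) ->
  (#|X| < n - k)%N ->
  M *m aG y *m signed_sum (fun h => [forall x in X, h x == x]) = 0.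
Proof.
move=> labk HM cX.
have [/existsP[u /existsP[w /and4P[uX wX uw /eqP luw]]]|no] := boolP
  [exists u, exists w, [&& u \notin X, w \notin X, u != w & lab (y^-1%g u) == lab
    (y^-1%g w)]]; last first.
  have : (#|~: X| <= k)%N.
    rewrite -[X in (_ <= X)%N]card_ord -(@card_in_imset _ _ (fun i => Ordinal (labk
      (y^-1%g i)))) ?max_card //.
    move=> u w; rewrite !inE => uX wX [] luw; apply/eqP; apply: contraT => uw.
    case/negP: no; apply/existsP; exists u; apply/existsP; exists w.
    by rewrite uX wX uw luw eqxx.
  have := cardsC X; rewrite card_ord; lia.
set S := signed_sum _; set Z := M *m _ *m _.
have tS : aG (tperm u w) *m S = (-1) ^+ e *: S.
  rewrite /S /signed_sum mulmx_sumr scaler_sumr [RHS](reindex_inj (mulgI (tperm u w)))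
    /=.
  apply: eq_big => [h|h _].
    apply: eq_forallb => x; case xX: (x \in X) => //=; rewrite permM tpermD //.
      by apply: contraNneq uX => ->.
    by apply: contraNneq wX => ->.
  by rewrite aGM -scalemxAr twist_signM twist_sign_tperm // scalerA mulrA -expr2
    sqrr_sign mul1r.
have : Z = - Z.
  rewrite -{1}[Z]scale1r -(sqrr_sign _ e) expr2 -scalerA {1}/Z scalemxAr -tS mulmxA.
  rewrite -(mulmxA M) -aGM.
  have -> : (y * tperm u w = tperm (y^-1 u) (y^-1 w) * y)%g.
    by rewrite -tpermJ conjgE invgK mulgA mulgKV.
  rewrite aGM mulmxA HM //; last by rewrite (inj_eq (@perm_inj _ _)).
  rewrite -!scalemxAl scalerA -/Z -signr_addb; case: (e); rewrite /= ?expr1 scaleN1r //.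
move/eqP; rewrite -addr_eq0 -mulr2n -scaler_nat scaler_eq0 pnatr_eq0 /=.
by move/eqP.
Qed.

End YoungKill.

Section Young.
Variables (n : nat) (la : seq nat).
Hypothesis la_part : is_part n la.
Local Notation aG := (regular_repr algC (symg n)).

Definition row_sum := \sum_(s : 'S_n | row_stab la s) aG s.
Definition col_sum := \sum_(s : 'S_n | col_stab la s) (-1) ^+ odd_perm s *: aG s.

Lemma sumn_la : sumn la = n.
Proof. by have /and3P[_ _ /eqP] := la_part. Qed.

Lemma lab_stab_M (lab : nat -> nat) (s t : 'S_n) :
  [forall k : 'I_n, lab (t k) == lab k] ->
  [forall k : 'I_n, lab ((s * t)%g k) == lab k] = [forall k : 'I_n, lab (s k) == lab k].
Proof. by move=> /forallP H; apply: eq_forallb => k; rewrite permM (eqP (H _)). Qed.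

Lemma lab_stab_Ml (lab : nat -> nat) (s t : 'S_n) :
  [forall k : 'I_n, lab (s k) == lab k] ->
  [forall k : 'I_n, lab ((s * t)%g k) == lab k] = [forall k : 'I_n, lab (t k) == lab k].
Proof.
move=> /forallP H; apply/forallP/forallP => K k.
  by have := K (s^-1%g k); rewrite permM permKV => /eqP ->; rewrite -(eqP (H _)) permKV.
by rewrite permM (eqP (K _)) (eqP (H _)).
Qed.

Lemma row_sum_r t : row_stab la t -> row_sum *m aG t = row_sum.
Proof.
move=> rt; rewrite /row_sum mulmx_suml [RHS](reindex_inj (mulIg t)) /=.
by apply: eq_big => [s|s _]; [rewrite /row_stab lab_stab_M | rewrite aGM].
Qed.

Lemma row_sum_l t : row_stab la t -> aG t *m row_sum = row_sum.
Proof.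
move=> rt; rewrite /row_sum mulmx_sumr [RHS](reindex_inj (mulgI t)) /=.
by apply: eq_big => [s|s _]; [rewrite /row_stab lab_stab_Ml | rewrite aGM].
Qed.

Lemma col_sum_r t : col_stab la t -> col_sum *m aG t = (-1) ^+ odd_perm t *: col_sum.
Proof.
move=> rt; rewrite /col_sum mulmx_suml scaler_sumr [RHS](reindex_inj (mulIg t)) /=.
apply: eq_big => [s|s _]; first by rewrite /col_stab lab_stab_M.
by rewrite -scalemxAl aGM scalerA odd_permM signr_addb mulrCA -signr_addb addbb mulr1.
Qed.

Lemma col_sum_l t : col_stab la t -> aG t *m col_sum = (-1) ^+ odd_perm t *: col_sum.
Proof.
move=> rt; rewrite /col_sum mulmx_sumr scaler_sumr [RHS](reindex_inj (mulgI t)) /=.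
apply: eq_big => [s|s _]; first by rewrite /col_stab lab_stab_Ml.
by rewrite -scalemxAr aGM scalerA odd_permM signr_addb mulrA -signr_addb addbb mul1r.
Qed.

Lemma lab_tperm (lab : nat -> nat) (u w : 'I_n) : lab u = lab w ->
  [forall k : 'I_n, lab (tperm u w k) == lab k].
Proof. by move=> e; apply/forallP => k; case: tpermP => [->|->|]; rewrite ?e. Qed.

Lemma row_lt (k : 'I_n) : (reshape_index la k < size la)%N.
Proof. by apply: reshape_indexP; rewrite sumn_la. Qed.

Lemma col_lt (k : 'I_n) : (reshape_offset la k < head 0%N la)%N.
Proof.
have := @reshape_offsetP la k; rewrite sumn_la => /(_ (ltn_ord k)) /leq_trans; apply.
have /and3P[+ _ _] := la_part; have := row_lt k.
case: la => // h t rl /= /(order_path_min (rev_trans leq_trans)) /allP H.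
by case: (reshape_index (h :: t) k) rl => //= j; rewrite ltnS => jt; apply/H/mem_nth.
Qed.

Lemma young_symmetrizerE : young_symmetrizer n la = row_sum *m col_sum.
Proof. by []. Qed.

Definition ycoef (x : 'S_n) : algC :=
  \sum_(p : 'S_n * 'S_n | [&& row_stab la p.1, col_stab la p.2 & (p.1 * p.2)%g == x])
     (-1) ^+ odd_perm p.2.

Lemma ycoefE : young_symmetrizer n la = \sum_(x in symg n) ycoef x *: aG x.
Proof.
rewrite young_symmetrizerE /row_sum /col_sum mulmx_suml.
under eq_bigr => s _ do rewrite mulmx_sumr.
rewrite pair_big /= (partition_big (fun p : 'S_n * 'S_n => (p.1 * p.2)%g) (mem (symg
  n))) /=; last first.
  by move=> p _; rewrite inE.
apply: eq_bigr => x _; rewrite scaler_suml; apply: eq_big => [p|p /andP[_ /eqP <-]].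
  by rewrite andbA.
by rewrite -scalemxAr aGM.
Qed.

Lemma ycoef_real x : ycoef x \is Num.real.
Proof. by rewrite rpred_sum // => p _; rewrite rpredX // rpredN rpred1. Qed.

Lemma card_fiber0 (lab : nat -> nat) (m : nat) (g : nat -> nat) :
  {in [pred c | (c < m)%N] &, injective g} ->
  (forall c, (c < m)%N -> (g c < n)%N /\ lab (g c) = 0%N) ->
  (forall k : 'I_n, lab k = 0%N -> exists2 c, (c < m)%N & g c = k) ->
  #|[set k : 'I_n | lab k == 0%N]| = m.
Proof.
move=> gI gP gS; rewrite -[RHS]card_ord.
pose g' (c : 'I_m) := Ordinal (proj1 (gP c (ltn_ord c))).
rewrite -[RHS](card_imset _ (f := g')); last first.
  by move=> c c' [] /gI e; apply/val_inj/e; rewrite inE.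
apply: eq_card => k; rewrite inE; apply/eqP/imsetP => [/gS[c cm e]|[c _ ->]].
  by exists (Ordinal cm) => //; apply/val_inj.
by case: (gP c (ltn_ord c)).
Qed.

Lemma card_row0 : #|[set k : 'I_n | reshape_index la k == 0%N]| = head 0%N la.
Proof.
apply: (card_fiber0 (g := id)) => [//|c|k k0].
  case E : la => [//|h t] /= ch; split; first by rewrite -sumn_la E /=;
    apply: leq_trans ch (leq_addr _ _).
  exact: (@flatten_indexKl (h :: t) 0 c).
exists (reshape_offset la k); first exact: col_lt.
by rewrite -[RHS](reshape_indexK la) k0 /flatten_index take0.
Qed.

Lemma card_col0 : #|[set k : 'I_n | reshape_offset la k == 0%N]| = size la.
Proof.
have nz c : (c < size la)%N -> (0 < nth 0%N la c)%N.
  move=> cs; have /and3P[_ z _] := la_part; rewrite lt0n.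
  by apply: contraNneq z => <-; apply: mem_nth.
apply: (card_fiber0 (lab := reshape_offset la) (g := fun r => flatten_index la r 0))
  => [c c'|c cs|k k0].
- rewrite !inE => /nz cs /nz cs' e.
  by rewrite -(flatten_indexKl cs) e flatten_indexKl.
- split; last by apply: flatten_indexKr; apply: nz.
  by rewrite -[X in (_ < X)%N]sumn_la; apply: flatten_indexP; apply: nz.
exists (reshape_index la k); first exact: row_lt.
by rewrite -[RHS](reshape_indexK la) k0.
Qed.

Lemma head_conj : head 0%N (conj_part la) = size la.
Proof.
have /and3P[_ z _] := la_part; rewrite /conj_part; case E: la z => [//|h t] z /=.
case: h E z => [|h] E z; first by rewrite inE eqxx in z.
rewrite /= add1n; congr S; apply/eqP; rewrite -all_count; apply/allP => x xt.
by rewrite lt0n; apply: contraNneq z => <-; rewrite inE xt orbT.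
Qed.

Lemma inj_onto_set (d : nat) (D : {set 'I_n}) : #|D| = d ->
  exists2 a : {ffun 'I_d -> 'I_n}, injective a & forall k, k \in D -> exists i, a i = k.
Proof.
move=> cD; exists [ffun i => enum_val (cast_ord (esym cD) i)].
  by move=> i j; rewrite !ffunE => /enum_val_inj /cast_ord_inj.
by move=> k kD; exists (cast_ord cD (enum_rank_in kD k));
  rewrite ffunE cast_ordK enum_rankK_in.
Qed.

Lemma stab_lab (d : nat) (a : {ffun 'I_d -> 'I_n}) (lab : nat -> nat) (h : 'S_n) :
  (forall k, k \in ~: [set k : 'I_n | lab k == 0%N] -> exists i, a i = k) ->
  stab a h -> [forall k : 'I_n, lab (h k) == lab k].
Proof.
move=> aD /stabP ha; apply/forallP => k.
have [k0|k0] := eqVneq (lab k) 0%N; last first.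
  by have [|i <-] := aD k; rewrite ?inE // ha.
have [hk0|hk0] := eqVneq (lab (h k)) 0%N; first by rewrite hk0 k0.
have [|i e] := aD (h k); first by rewrite !inE.
have ik : a i = k by apply: (@perm_inj _ h); rewrite ha.
by rewrite -e ik.
Qed.

Variable e : bool.
Hypothesis irr_la : part_char n la \in irr (symg n).

Local Notation E := (young_symmetrizer n la).

Lemma young_neq0 : E != 0.
Proof.
apply/eqP => E0; have /irrP[i ei] := irr_la.
have := irr1_neq0 i; rewrite -ei cfRepr1 pnatr_eq0 mxrank_eq0 cyclic_mx_eq0.
by rewrite E0 linear0 eqxx.
Qed.

(** If the coefficient vanished, then so would all M(a, x o a) by [mcoef_norm2],
    and the signed sum over the stabilizer of [a] would act as zero on the Specht
    module by [irr_trace_eq0]. Since [M] absorbs this sum, [M] would also act as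
    zero, whence E y E = 0 for all y and E = 0. *)
Lemma mcoef_neq0 (d : nat) (a : {ffun 'I_d -> 'I_n}) (M : 'M_#|symg n|) : injective a ->
  (forall h, stab a h -> aG h *m M = twist_sign e h *: M) ->
  ((forall y, E *m aG y *m M = 0) -> forall y, E *m aG y *m E = 0) ->
  mcoef (twist e (part_char n la)) a a != 0.
Proof.
move=> aI hM ME; apply/eqP => m0; case/eqP: young_neq0.
apply: (right_ideal_square ycoefE ycoef_real) => y _; move: y; apply: ME.
have fC := twistC e (part_char n la).
have f1 := twist_gt0 e irr_la.
have mx0 x : mcoef (twist e (part_char n la)) a [ffun i => (x : 'S_n) (a i)] = 0.
  have := mcoef_norm2 fC (twist_schur e irr_la) (twist_norm2 e irr_la) aI.
  rewrite m0 !mulr0 => /eqP; rewrite mulf_eq0 (gt_eqF f1) /= psumr_eq0; last first.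
    by move=> z _; apply: exprn_ge0.
  by move/allP/(_ x); rewrite mem_index_enum => /(_ isT);
    rewrite sqrf_eq0 normr_eq0 => /eqP.
pose c (h : 'S_n) := if stab a h then twist_sign e h else 0.
have T0 : \sum_(x in symg n) c x *: specht_repr n la x = 0.
  apply: irr_trace_eq0 => // y _.
  have := mx0 y; rewrite mcoef_app // => my0.
  rewrite (eq_bigl xpredT); last by move=> x; rewrite inE.
  transitivity (twist_sign e y * \sum_(h | stab a h) twist e (part_char n la) (y *
    h)%g); last first.
    by rewrite my0 mulr0.
  rewrite mulr_sumr [RHS]big_mkcond; apply: eq_bigr => h _.
  rewrite /c; case: ifP => _; last by rewrite mul0r.
  by rewrite fC /twist twist_signM [RHS]mulrA [X in _ = X * _]mulrCA twist_signK mulr1.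
have /(cyclic_annihil ycoefE) K := T0.
move=> y; have {}K := K y (in_setT y).
have : E *m aG y *m (\sum_(x in symg n) c x *: aG x) *m M = 0 by rewrite K mul0mx.
have -> : \sum_(x in symg n) c x *: aG x = \sum_(h | stab a h) twist_sign e h *: aG h.
  rewrite [RHS]big_mkcond; apply: eq_big => [x|x _]; first by rewrite inE.
  by rewrite /c; case: ifP => // _; rewrite scale0r.
rewrite -mulmxA mulmx_suml (eq_bigr (fun=> M)) => [|h sh]; last first.
  by rewrite -scalemxAl hM // scalerA twist_signK scale1r.
rewrite sumr_const -scaler_nat -scalemxAr => /eqP; rewrite scaler_eq0 pnatr_eq0.
by rewrite card_stab // (gtn_eqF (fact_gt0 _)) /= => /eqP.
Qed.

Lemma vanish_fix (X : {set 'I_n}) g :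
  (forall y, E *m aG y *m signed_sum e (fun h => [forall x in X, h x == x]) = 0) ->
  \sum_(h : 'S_n | [forall x in X, h x == x]) twist e (part_char n la) (h * g)%g = 0.
Proof.
move=> K; pose c (h : 'S_n) := if [forall x in X, h x == x] then twist_sign e h else 0.
have cE : \sum_(x in symg n) c x *: aG x = signed_sum e (fun h => [forall x in X, h x
  == x]).
  rewrite /signed_sum [RHS]big_mkcond; apply: eq_big => [x|x _]; first by rewrite inE.
  by rewrite /c; case: ifP => // _; rewrite scale0r.
have T0 : \sum_(x in symg n) c x *: specht_repr n la x = 0.
  by apply/(cyclic_annihil ycoefE) => y _; rewrite cE.
have : \tr ((\sum_(x in symg n) c x *: specht_repr n la x) *m specht_repr n la g) = 0.
  by rewrite T0 mul0mx mxtrace0.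
rewrite mulmx_suml linear_sum /= => H.
apply: etrans (etrans (congr1 (fun z => twist_sign e g * z) H) (mulr0 _)).
rewrite mulr_sumr big_mkcond; apply: eq_big => [x|x _]; first by rewrite inE.
rewrite -scalemxAl linearZ /= -repr_mxM ?inE // /c.
case: ifP => _; last by rewrite mul0r mulr0.
by rewrite /twist twist_signM cfunE inE mulr1n mulrCA mulrA.
Qed.

End Young.

(** If the level is [n] minus the first row, then [col_sum] kills, by
    [pigeonhole_kill], the sum over the stabilizer of fewer than [d] letters: more
    than [head 0 la] letters are free, and two of them share a column. The letters
    outside the first row are [d] in number, and [row_sum] absorbs their
    stabilizer. In the other case rows and columns are exchanged and the sums carry
    the sign; [col_sum], which then stands between [row_sum] and the sum to be
    killed, is expanded into group elements. *)
Lemma level_twist (n d : nat) (chi : 'CF(symg n)) : (0 < d)%N ->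
  chi \in irr (symg n) -> has_level chi d ->
  exists e, [/\ (d <= n)%N,
    (forall (B : {set 'I_n}) g, (#|B| < d)%N ->
       \sum_(h : 'S_n | [forall x in B, h x == x]) twist e chi (h * g)%g = 0) &
    exists2 a : {ffun 'I_d -> 'I_n}, injective a & mcoef (twist e chi) a a != 0].
Proof.
move=> d0 irr_chi [la [la_part chiE levE]]; move: irr_chi; rewrite chiE => irr_la.
have dn : (d <= n)%N by rewrite -levE /part_level; lia.
have [dE|dE] : d = (n - head 0 la)%N \/ d = (n - size la)%N.
  by move: levE; rewrite /part_level (head_conj la_part); lia.
- exists false; split=> // [B g cB|].
    apply: vanish_fix => // y; rewrite young_symmetrizerE -!(mulmxA (row_sum n la)).
    rewrite (pigeonhole_kill (lab := fun i => reshape_offset la i) (k := head 0%N la))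
      ?mulmx0 -?dE //.
      exact: col_lt.
    move=> u w uw luw; rewrite col_sum_r;
      last exact: (lab_tperm (lab := reshape_offset la)).
    by rewrite odd_tperm uw.
  have [|a aI aD] := @inj_onto_set n d (~: [set k : 'I_n | reshape_index la k == 0%N]).
    by rewrite dE -(card_row0 la_part) -[X in _ = (X - _)%N](card_ord n) -(cardsC [set
      k : 'I_n | reshape_index la k == 0%N]) addKn.
  exists a => //; apply: (mcoef_neq0 irr_la (M := row_sum n la)) => // [h sh|H y].
    by rewrite /twist_sign expr0 scale1r row_sum_l //; apply: stab_lab sh.
  by rewrite [in X in _ *m X]young_symmetrizerE mulmxA H mul0mx.
exists true; split=> // [B g cB|].
  apply: vanish_fix => // y; rewrite young_symmetrizerE -!(mulmxA (row_sum n la)).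
  set S := signed_sum _ _.
  have -> : col_sum n la *m regular_repr algC (symg n) y *m S =
      \sum_(s : 'S_n | col_stab la s)
        (-1) ^+ odd_perm s *: (regular_repr algC (symg n) (s * y)%g *m S).
    by rewrite /col_sum !mulmx_suml; apply: eq_bigr => s _; rewrite -!scalemxAl aGM.
  rewrite mulmx_sumr big1 // => s _; rewrite -scalemxAr mulmxA /S.
  rewrite (pigeonhole_kill (lab := fun i => reshape_index la i) (k := size la))
    ?scaler0 -?dE //.
    exact: row_lt.
  move=> u w uw luw; rewrite expr0 scale1r row_sum_r //;
    exact: (lab_tperm (lab := reshape_index la)).
have [|a aI aD] := @inj_onto_set n d (~: [set k : 'I_n | reshape_offset la k == 0%N]).
    by rewrite dE -(card_col0 la_part) -[X in _ = (X - _)%N](card_ord n) -(cardsC [set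
      k : 'I_n | reshape_offset la k == 0%N]) addKn.
exists a => //; apply: (mcoef_neq0 irr_la (M := col_sum n la)) => // [h sh|H y].
  by rewrite col_sum_l //; apply: stab_lab sh.
rewrite [in X in _ *m X]young_symmetrizerE.
have -> : row_sum n la *m col_sum n la =
    \sum_(s : 'S_n | row_stab la s) regular_repr algC (symg n) s *m col_sum n la.
  by rewrite /row_sum mulmx_suml.
by rewrite mulmx_sumr big1 // => s _;
  rewrite mulmxA -(mulmxA _ (regular_repr _ _ y)) -aGM H.
Qed.

From mathcomp Require Import all_classical all_reals all_analysis.

Import Order.TTheory GRing.Theory Num.Theory.

(** * The modulus as a real number *)

Section Modulus.
Variable R : realType.
Local Notation am := (@algC_modulus R).
Implicit Types (x y z : algC) (r p : rat).

Lemma modulus_has_sup x :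
  has_sup (ratr @` [set r : rat | (ratr r : algC) <= `|x|] : set R)%classic.
Proof.
split; first by exists (ratr 0); exists 0 => //=; rewrite rmorph0.
exists (Num.truncn `|x|).+1%:R => _ [r /= rx <-].
rewrite -(ratr_nat R) ler_rat -(ler_rat algC) ratr_nat.
apply: le_trans rx _; apply/ltW; have /andP[] := truncn_itv (normr_ge0 x); by [].
Qed.

Lemma modulus_ge_rat x r : (ratr r : algC) <= `|x| -> ratr r <= am x.
Proof. by move=> rx; apply: (ub_le_sup (modulus_has_sup x).2); exists r. Qed.

Lemma modulus_le_rat x (w : R) : (forall r, (ratr r : algC) <= `|x| -> ratr r <= w) ->
  am x <= w.
Proof. by move=> H; apply: (ge_sup (modulus_has_sup x).1) => _ [r rx <-]; apply: H. Qed.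

Lemma norm_le_rat x r : am x < ratr r -> `|x| <= ratr r.
Proof.
move=> H; have rr : (ratr r : algC) \is Num.real by apply: Creal_Crat; apply: Crat_rat.
rewrite real_leNgt ?normr_real //; apply/negP => /ltW /modulus_ge_rat;
  rewrite leNgt H //.
Qed.

Lemma modulus_ge0 x : 0 <= am x.
Proof. by rewrite -(rmorph0 (ratr : rat -> R)) modulus_ge_rat // rmorph0. Qed.

Lemma modulus_mono x y : `|x| <= `|y| -> am x <= am y.
Proof. by move=> xy; apply: modulus_le_rat => r rx;
  apply/modulus_ge_rat/le_trans/xy. Qed.

Lemma modulus_nat (n : nat) : am n%:R = n%:R.
Proof.
apply/le_anti/andP; split.
  apply: modulus_le_rat => r; rewrite normr_nat -(ratr_nat algC) ler_rat -(ler_rat R).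
  by rewrite ratr_nat.
by rewrite -(ratr_nat R) modulus_ge_rat // ratr_nat normr_nat.
Qed.

(** A rational number that is at most [x + y] but exceeds the sum of the moduli would
    also exceed [p + q] for rational numbers [p] and [q] above the two moduli; but
    such numbers are at least [x] and [y]. *)
Lemma modulusD x y : 0 <= x -> 0 <= y -> am (x + y) = am x + am y.
Proof.
move=> x0 y0; apply/le_anti/andP; split.
  apply: modulus_le_rat => r; rewrite ger0_norm ?addr_ge0 // => rxy.
  rewrite leNgt; apply/negP => H.
  have [p] : exists p, ratr p \in `]am x, (ratr r - am y)[ by apply: rat_in_itvoo; lra.
  rewrite in_itv /= => /andP[px pr].
  have [q] : exists q, ratr q \in `]am y, (ratr r - ratr p)[ by apply: rat_in_itvoo;
    lra.
  rewrite in_itv /= => /andP[qy qr].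
  have := lerD (norm_le_rat px) (norm_le_rat qy); rewrite !ger0_norm // => xypq.
  have := le_trans rxy xypq; rewrite -rmorphD /= ler_rat -(ler_rat R) rmorphD /=; lra.
rewrite -lerBrDr; apply: modulus_le_rat => r; rewrite ger0_norm // => rx.
rewrite lerBrDr -lerBrDl; apply: modulus_le_rat => s; rewrite ger0_norm // => sy.
rewrite lerBrDl -rmorphD; apply: modulus_ge_rat.
by rewrite rmorphD /= ger0_norm ?addr_ge0 // lerD.
Qed.

Lemma modulus_sum (I : Type) (s : seq I) (P : pred I) (F : I -> algC) :
  (forall i, P i -> 0 <= F i) -> am (\sum_(i <- s | P i) F i) = \sum_(i <- s | P i) am
    (F i).
Proof.
move=> F0; elim: s => [|i s IH]; first by rewrite !big_nil; apply: (modulus_nat 0).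
rewrite !big_cons; case: ifP => // Pi; rewrite modulusD ?IH //; first exact: F0.
exact: sumr_ge0.
Qed.

Lemma modulus_natM n x : 0 <= x -> am (n%:R * x) = n%:R * am x.
Proof.
move=> x0; elim: n => [|n IH]; first by rewrite !mul0r; apply: (modulus_nat 0).
by rewrite -!natr1 !mulrDl !mul1r modulusD // ?IH // mulr_ge0.
Qed.

Lemma modulus_ratM r x : 0 <= r -> 0 <= x -> am (ratr r * x) = ratr r * am x.
Proof.
move=> r0 x0.
pose a := `|numq r|%N; pose b := `|denq r|%N.
have b0 : (0 < b)%N by rewrite absz_gt0 denq_eq0.
have rE : r = a%:R / b%:R.
  by rewrite -{1}(divq_num_den r) /a /b !natr_absz !ger0_norm ?numq_ge0 ?denq_ge0.
have bR : b%:R != 0 :> R by rewrite pnatr_eq0 -lt0n.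
have bC : b%:R != 0 :> algC by rewrite pnatr_eq0 -lt0n.
apply: (mulfI bR); rewrite -modulus_natM; last by rewrite mulr_ge0 // ler0q.
have -> : b%:R * (ratr r * x) = a%:R * x :> algC.
  by rewrite rE rmorphM /= fmorphV /= !ratr_nat; field.
by rewrite modulus_natM // rE rmorphM /= fmorphV /= !ratr_nat; field.
Qed.

(** Homogeneity over the rational numbers follows from additivity; monotonicity and the
    density of the rational numbers extend it to all factors [y]. *)
Lemma modulusM x y : am (x * y) = am x * am y.
Proof.
wlog [x0 y0] : x y / 0 <= x /\ 0 <= y.
  move=> H; have E z : am z = am `|z| by rewrite /algC_modulus normr_id.
  by rewrite E normrM (E x) (E y); apply: H.
have [ax0|axN] := eqVneq (am x) 0.
  rewrite ax0 mul0r; apply/le_anti/andP; split; last exact: modulus_ge0.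
  have yb : y <= (Num.truncn y).+1%:R by have /andP[_ /ltW] := truncn_itv y0.
  apply: (@le_trans _ _ (am ((Num.truncn y).+1%:R * x)));
    last by rewrite modulus_natM // ax0 mulr0.
  by apply: modulus_mono; rewrite !normrM mulrC ler_wpM2r // normr_nat ger0_norm.
have ax : 0 < am x by rewrite lt_def axN modulus_ge0.
apply/le_anti/andP; split.
  rewrite -ler_pdivrMl // mulrC leNgt; apply/negP => H.
  have [p] := rat_in_itvoo H; rewrite in_itv /= => /andP[py pr].
  have yp := norm_le_rat py.
  have p0 : 0 <= p by move: (le_trans (modulus_ge0 y) (ltW py)); rewrite ler0q.
  have : am (x * y) <= ratr p * am x.
    rewrite -modulus_ratM //; apply: modulus_mono;
      rewrite (normrM x y) (normrM (ratr p) x) mulrC ler_wpM2r //.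
    by rewrite [leRHS]ger0_norm ?ler0q.
  by rewrite -ler_pdivrMr // leNgt pr.
rewrite -ler_pdivlMl //; apply: modulus_le_rat => p py; rewrite ler_pdivlMl //.
have [p0|p0] := leP 0 p; last first.
  by apply: le_trans (modulus_ge0 _); rewrite pmulr_rle0 // lerq0 ltW.
rewrite mulrC -modulus_ratM //; apply: modulus_mono;
  rewrite (normrM x y) (normrM (ratr p) x) mulrC ler_wpM2l //.
by rewrite [leLHS]ger0_norm ?ler0q.
Qed.

End Modulus.

(** * The norm estimate *)

Section PowerMean.
Variables (R : realType) (q : R).
Hypothesis q2 : 2 <= q.

Let q0 : 0 < q. Proof. by apply: lt_le_trans q2. Qed.
Let q1 : 0 < q - 1. Proof. by rewrite subr_gt0; apply: lt_le_trans q2;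
  rewrite ltr1n. Qed.
Let qN : q != 0. Proof. exact: lt0r_neq0. Qed.
Let q1N : q - 1 != 0. Proof. exact: lt0r_neq0. Qed.

Lemma powR_le (x y r : R) : 0 <= r -> 0 <= x -> x <= y -> x `^ r <= y `^ r.
Proof.
move=> r0 x0 xy; apply: ge0_ler_powR => //; rewrite nnegrE //; exact: le_trans xy.
Qed.

(** Young's inequality for the product of [a] and [1]. *)
Lemma bernoulli_powR (a : R) : 0 <= a -> q * a <= a `^ q + (q - 1).
Proof.
move=> a0; have := @conjugate_powR R a 1 q (q / (q - 1)) a0 ler01 q0.

rewrite divr_gt0 // powR1 mulr1 => /(_ isT).
have -> : q^-1 + (q / (q - 1))^-1 = 1 by field; rewrite qN q1N.
move=> /(_ erefl); rewrite -(ler_pM2l q0) mulrDr.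
have -> : q * (a `^ q / q) = a `^ q by field.
by have -> : q * (1 / (q / (q - 1))) = q - 1 by field; rewrite qN q1N.
Qed.

(** Sum Bernoulli's inequality over the values divided by their mean. *)
Lemma weighted_power_mean (I : finType) (c v : I -> R) :
  (forall i, 0 <= c i) -> (forall i, 0 <= v i) ->
  (\sum_i c i * v i) `^ q <= (\sum_i c i) `^ (q - 1) * \sum_i c i * v i `^ q.
Proof.
move=> c0 v0; set W := \sum_i c i; set S := \sum_i c i * v i.
have W0 : 0 <= W by apply: sumr_ge0.
have S0 : 0 <= S by apply: sumr_ge0 => i _; apply: mulr_ge0.
have rhs0 : 0 <= W `^ (q - 1) * \sum_i c i * v i `^ q.
  by rewrite mulr_ge0 ?powR_ge0 // sumr_ge0 // => i _; rewrite mulr_ge0 ?powR_ge0.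
have [Se0|SN] := eqVneq S 0; first by rewrite Se0 powR0.
have Sp : 0 < S by rewrite lt_def SN.
have Wp : 0 < W.
  rewrite lt_def W0 andbT; apply: contraNneq SN => We0.
  rewrite /S big1 // => i _.
  have /eqP := We0; rewrite psumr_eq0 // => /allP/(_ i);
    rewrite mem_index_enum => /(_ isT)/eqP ->.
  by rewrite mul0r.
pose mu := S / W; have mup : 0 < mu by rewrite divr_gt0.
have H : W <= \sum_i c i * (v i / mu) `^ q.
  have : \sum_i c i * (q * (v i / mu)) <= \sum_i c i * ((v i / mu) `^ q + (q - 1)).
    by apply: ler_sum => i _; rewrite ler_wpM2l // bernoulli_powR // divr_ge0 // ltW.
  have -> : \sum_i c i * (q * (v i / mu)) = q * W.
    transitivity (q / mu * S); last by rewrite /mu; field; apply/andP; split;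
      apply: lt0r_neq0.
    by rewrite /S mulr_sumr; apply: eq_bigr => i _; field; apply: lt0r_neq0.
  under [leRHS]eq_bigr => i _ do rewrite mulrDr.
  rewrite big_split /= -mulr_suml -/W; lra.
have E : \sum_i c i * (v i / mu) `^ q = (\sum_i c i * v i `^ q) / mu `^ q.
  rewrite mulr_suml; apply: eq_bigr => i _; rewrite -mulrA; congr (_ * _).
  apply: (mulIf (lt0r_neq0 (powR_gt0 q mup))); rewrite divfK ?lt0r_neq0 ?powR_gt0 //.
  by rewrite -powRM ?divfK ?lt0r_neq0 // ?divr_ge0 // ltW.
have -> : S = W * mu by rewrite /mu; field; apply: lt0r_neq0.
rewrite (powRM _ (ltW Wp) (ltW mup)).
have -> : W `^ q = W `^ (q - 1) * W by rewrite mulrC mulr_powRB1.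
rewrite -mulrA ler_wpM2l ?powR_ge0 // -ler_pdivlMr ?powR_gt0 //.
by rewrite -E.
Qed.

Lemma powR_le_sqr (v : R) : 0 <= v <= 1 -> v `^ q <= v ^+ 2.
Proof.
move=> /andP[v0 v1]; have [->|vN] := eqVneq v 0.
  by rewrite powR0 ?expr0n.
rewrite -powR_mulrn //; apply: ger_powR => //; rewrite v1 lt_def vN v0 //.
Qed.

Lemma geo_sum_le (s : R) m : 0 <= s <= 1 / 2 -> \sum_(k < m) s ^+ k <= expR (2 * s).
Proof.
move=> /andP[s0 s1]; apply: le_trans (expR_ge1Dx _).
have : (1 - s) * \sum_(k < m) s ^+ k <= (1 - s) * (1 + 2 * s).
  have -> : (1 - s) * \sum_(k < m) s ^+ k = 1 - s ^+ m by rewrite -[RHS]opprB subrX1;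
    ring.
  have := exprn_ge0 m s0; nra.
by rewrite ler_pM2l //; lra.
Qed.

Lemma ln_gt0_of_ge2 : 0 < ln q.
Proof. by apply: ln_gt0; apply: lt_le_trans q2; rewrite ltr1n. Qed.

Lemma ln_le_half : ln q / q <= 1 / 2.
Proof.
rewrite ler_pdivrMr // -ler_expR lnK ?posrE //.
have H1 := @expR_ge1Dx R (q / 4).
have -> : 1 / 2 * q = q / 4 + q / 4 by field.
have qp := ltW q0; have x0 : 0 <= 1 + q / 4 by lra.
rewrite expRD; apply: le_trans (ler_pM x0 x0 H1 H1).
rewrite -subr_ge0; have -> : (1 + q / 4) * (1 + q / 4) - q = (1 - q / 4) ^+ 2 by field.
exact: sqr_ge0.
Qed.

(** Each geometric sum is at most [expR (2 * t ^+ #|S|)] with [t = ln q / q]. The sum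
    of [t ^+ #|S|] over all sets is [(1 + t) ^+ Q], at most [expR (Q * t)], and
    [q * t] is [ln q]. *)
Lemma subset_prod_le (Q m : nat) : Q%:R <= q ->
  \prod_(S : {set 'I_Q} | S != finset.set0) \sum_(k < m) (ln q / q) ^+ (#|S| * k)
  <= expR (2 * q).
Proof.
move=> Qq; set t := ln q / q.
have t0 : 0 < t by rewrite divr_gt0 // ln_gt0_of_ge2.
have t1 : t <= 1 / 2 by apply: ln_le_half.
apply: (@le_trans _ _ (\prod_(S : {set 'I_Q} | S != finset.set0) expR (2 * t ^+ #|S|))).
  apply: ler_prod => S S0; apply/andP; split.
    by apply: sumr_ge0 => k _; apply/exprn_ge0/ltW.
  under eq_bigr => k _ do rewrite exprM.
  apply: geo_sum_le; rewrite exprn_ge0 ?(ltW t0) //=.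
  move: S0; rewrite -card_gt0; case: #|S| => // j _; rewrite exprS.
  have : t ^+ j <= 1 by apply: exprn_ile1; lra.
  have := exprn_ge0 j (ltW t0); nra.
rewrite -expR_sum ler_expR -mulr_sumr ler_pM2l //.
apply: (@le_trans _ _ (\sum_(S : {set 'I_Q}) t ^+ #|S|)).
  by rewrite [leRHS](bigID (fun S => S != finset.set0)) /= lerDl sumr_ge0 // => S _;
    apply/exprn_ge0/ltW.
have -> : \sum_(S : {set 'I_Q}) t ^+ #|S| = (t + 1) ^+ Q.
  rewrite -sum_subset_exp; apply: eq_bigr => S _; by rewrite expr1n mulr1.
apply: (@le_trans _ _ (expR t ^+ Q)).
  by apply: lerXn2r; rewrite ?nnegrE ?expR_ge0 ?addr_ge0 ?(ltW t0) // addrC expR_ge1Dx.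
rewrite -expRM_natl; apply: (@le_trans _ _ (expR (q * t))).
  by rewrite ler_expR ler_wpM2r // ltW.
have -> : q * t = ln q by rewrite /t; field.
by rewrite lnK ?posrE.
Qed.

(** The power mean inequality for the weights [c y u] leaves a factor
    [(\sum_u c y u) `^ (q - 1)], which [card_intertwines] bounds by the number of
    invariant sets to the power [q - 1]; the exponent is raised to the integer
    [Q = truncn q], so that the moment can be counted. As the [v u] are at most
    [1], their powers are at most their squares. *)
Lemma power_sum_bound (n d : nat) (F : 'S_n -> R) (v : 'S_d -> R) (K : R) :
  (0 < d)%N -> 0 < K -> (forall y, 0 <= F y) -> (forall t, 0 <= v t <= 1) ->
  (forall y, F y <= 4 ^+ d * K * \sum_t #|[pred p | pinj p && intertwines y t p]|%:R *
    v t) ->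
  \sum_t v t ^+ 2 <= (d`!%:R * K ^+ 2)^-1 ->
  (n`!%:R^-1 * \sum_y F y `^ q) `^ q^-1 <=
    (16 * expR 2 * (q / ln q)) ^+ d * (K * d`!%:R) `^ (1 - 2 / q).
Proof.
move=> d0 K0 F0 v01 FK vK.
pose c y t := #|[pred p : {ffun 'I_d -> option 'I_n} | pinj p && intertwines y t p]|.
pose Z (y : 'S_n) := #|inv_sets d y|.
have cZ y : (\sum_t c y t <= d`! * Z y)%N.
  apply: leq_trans (card_intertwines d y); rewrite -sum1_card.
  rewrite (partition_big (fun z : {ffun 'I_d -> option 'I_n} * 'S_d => z.2) xpredT) //=.
  apply: leq_sum => t _; rewrite /c -sum1_card.
  rewrite [leqRHS](reindex_onto (fun p => (p, t)) fst) /=;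
    last by move=> [p t'] /andP[_ /eqP] /= ->.
  by apply: eq_leq; apply: eq_bigl => p; rewrite !inE !eqxx !andbT.
have Z1 y : (0 < Z y)%N.
  by apply/card_gt0P; exists finset.set0; rewrite !inE cards0 imset0 eqxx.
pose Q := Num.truncn q.
have [Qq qQ] : Q%:R <= q /\ q < Q.+1%:R by apply/andP; apply: truncn_itv; apply: ltW.
pose t := ln q / q.
have t0 : 0 < t by rewrite divr_gt0 // ln_gt0_of_ge2.
have t1 : t <= 1 by apply: le_trans ln_le_half _; lra.
pose O := ((2 ^ Q).+1 ^ d)%:R * expR (2 * q) / t ^+ (d * Q).
have O0 : 0 < O.
  by rewrite divr_gt0 ?exprn_gt0 // mulr_gt0 ?expR_gt0 // ltr0n expn_gt0.
have moment u : \sum_y (Z y)%:R ^+ Q * (c y u)%:R <= n`!%:R * O.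
  have -> : \sum_y (Z y)%:R ^+ Q * (c y u)%:R = (\sum_y Z y ^ Q * c y u)%:R :> R.
    by rewrite natr_sum; apply: eq_bigr => y _; rewrite natrM natrX.
  rewrite /O !mulrA ler_pdivlMr ?exprn_gt0 //.
  apply: le_trans (moment_inv_sets n Q u t0 t1) _.
  rewrite -!mulrA ler_pM2l ?ltr0n ?fact_gt0 // ler_pM2l ?ltr0n ?expn_gt0 //.
  exact: subset_prod_le.
have step y : F y `^ q <= (4 ^+ d * K) `^ q * ((d`!%:R) `^ (q - 1) *
    \sum_u (Z y)%:R ^+ Q * (c y u)%:R * v u ^+ 2).
  have AK0 : 0 <= 4 ^+ d * K by rewrite mulr_ge0 ?exprn_ge0 // ltW.
  apply: le_trans (powR_le (ltW q0) (F0 y) (FK y)) _.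
  have s0 : 0 <= \sum_u (c y u)%:R * v u by apply: sumr_ge0 => u _;
    rewrite mulr_ge0 //; case/andP: (v01 u).
  rewrite (powRM _ AK0 s0) ler_wpM2l ?powR_ge0 //.
  have v0 u : 0 <= v u by case/andP: (v01 u).
  apply: le_trans (@weighted_power_mean _ (fun u => (c y u)%:R) v (fun=> ler0n _ _)
    v0) _.
  apply: (@le_trans _ _ ((d`!%:R * (Z y)%:R) `^ (q - 1) * \sum_u (c y u)%:R * v u ^+
    2)).
    apply: ler_pM; first exact: powR_ge0.
    - by apply: sumr_ge0 => u _; rewrite mulr_ge0 ?powR_ge0.
    - apply: powR_le; [exact: ltW| exact: sumr_ge0|].
      by rewrite -natr_sum -natrM ler_nat.
    by apply: ler_sum => u _; rewrite ler_wpM2l // powR_le_sqr.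
  rewrite powRM // -mulrA ler_wpM2l ?powR_ge0 //.
  under [leRHS]eq_bigr => u _ do rewrite -mulrA.
  rewrite -mulr_sumr ler_wpM2r //; first by apply: sumr_ge0 => u _;
    rewrite mulr_ge0 ?exprn_ge0.
  rewrite -powR_mulrn //; apply: ler_powR; first by rewrite ler1n.
  by rewrite lerBlDr natr1 ltW.
have total : \sum_y F y `^ q <= n`!%:R * ((4 ^+ d) `^ q * O * (K * d`!%:R) `^ (q - 2)).
  apply: le_trans (ler_sum _ (fun y _ => step y)) _.
  rewrite -mulr_sumr -mulr_sumr exchange_big /=.
  have AK : (4 ^+ d * K) `^ q = (4 ^+ d) `^ q * K `^ q by rewrite powRM ?exprn_ge0 //
    ltW.
  rewrite AK.
  apply: (@le_trans _ _ ((4 ^+ d) `^ q * K `^ q * (d`!%:R `^ (q - 1) * (n`!%:R * O *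
    (d`!%:R * K ^+ 2)^-1)))).
    rewrite ler_wpM2l ?mulr_ge0 ?powR_ge0 // ler_wpM2l ?powR_ge0 //.
    apply: (@le_trans _ _ (\sum_u n`!%:R * O * v u ^+ 2)).
      by apply: ler_sum => u _; rewrite -mulr_suml ler_wpM2r ?sqr_ge0 ?moment.
    by rewrite -mulr_sumr ler_wpM2l // mulr_ge0 // ltW.
  have dR : 0 < d`!%:R :> R by rewrite ltr0n fact_gt0.
  have -> : K `^ q = K ^+ 2 * K `^ (q - 2).
    rewrite -powR_mulrn ?(ltW K0) // -powRD; last by rewrite (gt_eqF K0) implybT.
    by congr (_ `^ _); ring.
  have -> : d`!%:R `^ (q - 1) = d`!%:R * d`!%:R `^ (q - 2) :> R.
    rewrite -{2}[d`!%:R]powRr1 ?(ltW dR) // -powRD; last by rewrite (gt_eqF dR) implybT.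
    by congr (_ `^ _); ring.
  rewrite (powRM _ (ltW K0) (ltW dR)).
  set A := (4 ^+ d) `^ q; set B := K `^ _; set D := _ `^ (q - 2).
  rewrite le_eqVlt; apply/orP; left; apply/eqP; field.
  by rewrite !lt0r_neq0.
have nR : 0 < n`!%:R :> R by rewrite ltr0n fact_gt0.
have X0 : 0 < K * d`!%:R by rewrite mulr_gt0 // ltr0n fact_gt0.
have sum0 : 0 <= \sum_y F y `^ q by apply: sumr_ge0 => y _; apply: powR_ge0.
apply: (@le_trans _ _ (((4 ^+ d) `^ q * O * (K * d`!%:R) `^ (q - 2)) `^ q^-1)).
  apply: powR_le; rewrite ?invr_ge0 ?(ltW q0) //;
    first by rewrite mulr_ge0 ?invr_ge0 // ltW.
  by rewrite ler_pdivrMl.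
have p4 : 0 <= (4 ^+ d : R) `^ q by apply: powR_ge0.
have powR3 (A B C r : R) : 0 <= A -> 0 <= B -> 0 <= C ->
    (A * B * C) `^ r = A `^ r * B `^ r * C `^ r.
  by move=> A0 B0 C0; rewrite powRM ?mulr_ge0 // powRM.
rewrite powR3 ?powR_ge0 ?(ltW O0) //.
rewrite -(powRrM _ q q^-1) mulfV // powRr1 ?exprn_ge0 // -(powRrM _ (q - 2) q^-1).
have -> : (q - 2) / q = 1 - 2 / q by field.
rewrite ler_wpM2r ?powR_ge0 //.
have w0 : 0 <= q / ln q by rewrite divr_ge0 ?(ltW q0) ?(ltW ln_gt0_of_ge2).
(* The colourings of the d indices are at most 4 ^ (d Q) in number, the
   generating function is at most exp (2 q), and the last factor is a power of
   q / ln q. *)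
have OB : O <= (4 ^+ d * expR 2 * (q / ln q) ^+ d) `^ q.
  rewrite powR3 ?exprn_ge0 ?expR_ge0 // /O -mulrA -[leRHS]mulrA.
  have dq0 : 0 <= d%:R * q by rewrite mulr_ge0 // ltW.
  apply: ler_pM => //; first by rewrite divr_ge0 ?expR_ge0 // exprn_ge0 // ltW.
    rewrite -(powR_mulrn d (_ : 0 <= 4)) // -powRrM mulrC powRrM powR_mulrn ?powR_ge0
      //.
    rewrite natrX; apply: lerXn2r; rewrite ?nnegrE ?powR_ge0 //.
    apply: (@le_trans _ _ (4 ^+ Q)).
      rewrite -natrX ler_nat.
      have Q1 : (0 < Q)%N by rewrite -(ltr0n R) -(ltrD2r 1) natr1;
        apply: le_lt_trans qQ; have := q2; lra.
      have -> : 4%N = (2 * 2)%N by []. rewrite expnMn.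
      have : (2 <= 2 ^ Q)%N by rewrite -{1}(expn1 2) leq_exp2l.
      move: (2 ^ Q)%N => z z2; apply: (@leq_trans (2 * z));
        last by rewrite leq_mul2r z2 orbT.
      by rewrite mul2n -addnn -addn1 leq_add2l ltnW.
    by rewrite -powR_mulrn //; apply: ler_powR => //; rewrite ler1n.
  apply: ler_pM; rewrite ?expR_ge0 ?invr_ge0 ?exprn_ge0 ?(ltW t0) //.
    by rewrite /powR gt_eqF ?expR_gt0 // expRK mulrC.
  have -> : (q / ln q) = t^-1 by rewrite /t invf_div.
  rewrite -exprVn -(powR_mulrn (d * Q)) ?invr_ge0 ?(ltW t0) // -powR_mulrn ?invr_ge0
    ?(ltW t0) // -powRrM.
  apply: ler_powR; first by rewrite invf_ge1.
  by rewrite natrM ler_wpM2l.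
have rhs0 : 0 <= 4 ^+ d * expR 2 * (q / ln q) ^+ d by rewrite !mulr_ge0 ?exprn_ge0
  ?expR_ge0.
have Oq : O `^ q^-1 <= 4 ^+ d * expR 2 * (q / ln q) ^+ d.
  apply: le_trans (powR_le _ (ltW O0) OB) _; first by rewrite invr_ge0 ltW.
  by rewrite -powRrM mulfV // powRr1.
apply: le_trans (ler_wpM2l (exprn_ge0 d _) Oq) _; first by [].
have <- : (4 * 4) ^+ d * expR 2 * (q / ln q) ^+ d = 4 ^+ d * (4 ^+ d * expR 2 * (q /
  ln q) ^+ d) :> R.
  by rewrite (exprMn _ (4 : R)) !mulrA.
have e16 : 16 = 4 * 4 :> R by rewrite -natrM.
rewrite [leRHS]exprMn ler_wpM2r ?exprn_ge0 // e16 [leRHS]exprMn ler_wpM2l ?exprn_ge0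
  ?mulr_ge0 //.
case: (d) d0 => // j _; rewrite exprS ler_peMr ?expR_ge0 // exprn_ege1 //.
by rewrite -[leLHS]expR0 ler_expR.
Qed.

End PowerMean.

Lemma ffact_expn_le n d : (d <= n)%N -> (n ^ d * d`! <= d ^ d * n ^_ d)%N.
Proof.
move=> dn; rewrite -ffactnn !ffact_prod.
have -> : (n ^ d = \prod_(i < d) n)%N by rewrite prod_nat_const card_ord.
have -> : (d ^ d = \prod_(i < d) d)%N by rewrite prod_nat_const card_ord.
rewrite -!big_split /=; apply: leq_prod => i _; have := ltn_ord i; nia.
Qed.

Lemma card_injs n d : #|injections n d| = n ^_ d.
Proof.
have := card_inj_ffuns 'I_d 'I_n; rewrite !card_ord => <-.
by apply: eq_card => a; rewrite !inE.
Qed.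

(** * Small and large degrees *)

Section Final.
Variables (R : realType) (q : R).
Hypothesis q2 : 2 <= q.
Local Notation am := (@algC_modulus R).

Let q0 : 0 < q. Proof. by apply: lt_le_trans q2. Qed.
Let qN : q != 0. Proof. exact: lt0r_neq0. Qed.

Lemma modulus_norm (z : algC) : am `|z| = am z.
Proof. by rewrite /algC_modulus normr_id. Qed.

Lemma modulus_gt0 (z : algC) : z != 0 -> 0 < am z.
Proof.
move=> z0; rewrite lt_def modulus_ge0 andbT; apply: contraNneq z0 => az.
have : am (z * z^-1) = 0 by rewrite modulusM az mul0r.
have [->//|z0] := eqVneq z 0.
by rewrite mulfV // -[1]/(1%:R) modulus_nat => /eqP; rewrite oner_eq0.
Qed.

Lemma exponent_ge0 : 0 <= 1 - 2 / q.
Proof. by rewrite subr_ge0 ler_pdivrMr // mul1r. Qed.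

(** [F ^ q <= f1 ^ (q - 2) * F ^ 2] gives the bound [f1 ^ (1 - 2 / q)]; the factor
    [(d / n) ^ (d (1 - 2 / q))], at least [3 ^ (- d)], is absorbed by the constant. *)
Lemma small_n_bound (n d : nat) (F : 'S_n -> R) (f1 : R) :
  (0 < d)%N -> (d <= n)%N -> (n < 3 * d)%N -> 0 < f1 -> (forall s, 0 <= F s <= f1) ->
  \sum_s F s ^+ 2 = n`!%:R ->
  (n`!%:R^-1 * \sum_s F s `^ q) `^ q^-1 <=
   (16 * expR 2 * q / ln q) ^+ d * ((d%:R ^+ d * f1) / n%:R ^+ d) `^ (1 - 2 / q).
Proof.
move=> d0 dn n3 f10 Ff F2.
have nR : 0 < n`!%:R :> R by rewrite ltr0n fact_gt0.
have q20 : 0 <= q - 2 by rewrite subr_ge0.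
have dR : 0 < d%:R :> R by rewrite ltr0n.
have n0R : 0 < n%:R :> R by rewrite ltr0n; apply: leq_trans dn.
have step s : F s `^ q <= f1 `^ (q - 2) * F s ^+ 2.
  have /andP[Fs0 Fs1] := Ff s.
  have [->|FN] := eqVneq (F s) 0; first by rewrite powR0 // expr0n mulr0.
  have -> : F s `^ q = F s `^ (q - 2) * F s ^+ 2.
    rewrite -powR_mulrn // -powRD ?FN ?implybT //; congr (_ `^ _); ring.
  by rewrite ler_wpM2r ?sqr_ge0 // powR_le.
have L : n`!%:R^-1 * \sum_s F s `^ q <= f1 `^ (q - 2).
  rewrite ler_pdivrMl // mulrC -F2 mulr_sumr; exact: ler_sum.
apply: le_trans (powR_le _ _ L) _.
- by rewrite invr_ge0 ltW.
- by rewrite mulr_ge0 ?invr_ge0 // sumr_ge0 // => s _; apply: powR_ge0.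
rewrite -powRrM; have -> : (q - 2) / q = 1 - 2 / q by field.
have -> : d%:R ^+ d * f1 / n%:R ^+ d = (d%:R / n%:R) ^+ d * f1 :> R.
  by rewrite exprMn exprVn mulrAC.
have x0 : 0 <= d%:R / n%:R :> R by rewrite divr_ge0 // ltW.
rewrite powRM ?exprn_ge0 ?(ltW f10) // mulrA ler_peMl ?powR_ge0 //.
have x1 : 0 < (d%:R / n%:R : R) ^+ d <= 1.
  by rewrite exprn_gt0 ?divr_gt0 //= exprn_ile1 // ler_pdivrMr // mul1r ler_nat.
have s1 : 1 - 2 / q <= 1 by rewrite gerBl divr_ge0 // ltW.
apply: le_trans (ler_wpM2l _ (ger1_powR x1 s1)); last first.
  by rewrite exprn_ge0 // !mulr_ge0 ?expR_ge0 ?(ltW q0) // invr_ge0 ltW //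
    ln_gt0_of_ge2.
rewrite -exprMn exprn_ege1 //.
have lq := ln_le_half q2; have lp := ln_gt0_of_ge2 q2.
have e1 : 1 <= expR 2 :> R by rewrite -[leLHS]expR0 ler_expR.
have w2 : 2 <= q / ln q.
  by rewrite ler_pdivlMr // -ler_pdivlMl // mulrC; move: lq;
    rewrite ler_pdivrMr // mul1r mulrC.
have y3 : 3^-1 <= d%:R / n%:R :> R.
  by rewrite ler_pdivlMr // ler_pdivrMl // -natrM ler_nat ltnW.
have -> : 16 * expR 2 * q / ln q * (d%:R / n%:R) = 16 * expR 2 * ((q / ln q) * (d%:R /
  n%:R)) by field; rewrite !lt0r_neq0.
have h : 2 * 3^-1 <= (q / ln q) * (d%:R / n%:R) by apply: ler_pM; rewrite ?invr_ge0.
move: h e1; move: (_ * (d%:R / n%:R)) (expR 2) => u w h e1; nra.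
Qed.

(** [power_sum_bound] for the normalized coefficients [v t = |M(a, a o t)| / M(a, a)] and
    for [K = f(1) / (n (n - 1) ... (n - d + 1))]. The bound of the squares of the
    [v t] combines [mcoef_sum2] with [mcoef_injections_ge], and [K d!] is
    [f(1)] divided by a binomial coefficient, which is at least [(n / d) ^ d]. *)
Lemma large_n_bound (n d : nat) (f : 'S_n -> algC) (a : {ffun 'I_d -> 'I_n}) :
  (forall s t, f (s * t)%g = f (t * s)%g) ->
  (forall phi : 'S_n -> algC, (forall s t, phi (s * t)%g = phi (t * s)%g) ->
    forall y, f 1%g * \sum_x phi x * f (x * y)%g = (\sum_x phi x * f x) * f y) ->
  \sum_x `|f x| ^+ 2 = n`!%:R -> 0 < f 1%g ->
  (forall (B : {set 'I_n}) g, (#|B| < d)%N ->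
     \sum_(h : 'S_n | [forall x in B, h x == x]) f (h * g)%g = 0) ->
  injective a -> mcoef f a a != 0 ->
  (0 < d)%N -> (3 * d <= n)%N ->
  (n`!%:R^-1 * \sum_s am (f s) `^ q) `^ q^-1 <=
   (16 * expR 2 * q / ln q) ^+ d * ((d%:R ^+ d * am (f 1%g)) / n%:R ^+ d) `^ (1 - 2 /
     q).
Proof.
move=> fC fS fN f1 fV aI m0 d0 n3.
have [dn n0 n3'] : [/\ d <= n, 0 < n & n <= 3 * (n - 2 * d)]%N by split; clear -d0 n3;
  lia.
pose M := am (mcoef f a a); have M0 : 0 < M by apply: modulus_gt0.
pose F1 := am (f 1%g); have F10 : 0 < F1 by apply: modulus_gt0; rewrite lt0r_neq0.
have N0 : 0 < (n ^_ d)%:R :> R by rewrite ltr0n ffact_gt0.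
pose K := F1 / (n ^_ d)%:R; have K0 : 0 < K by rewrite divr_gt0.
pose u t := am (mcoef f a (precomp a t)); pose v t := u t / M.
have u0 t : 0 <= u t by apply: modulus_ge0.
have mg := mcoef_ge0 fC fS fN f1 aI.
have Dd : 0 < d`!%:R :> R by rewrite ltr0n fact_gt0.
have Dn : 0 < (n - d)`!%:R :> R by rewrite ltr0n fact_gt0.
have kappa : (d`! * (n - d)`!)%:R * F1 <= (n ^_ d)%:R * M.
  have := mcoef_injections_ge fC fS fN f1 aI m0; rewrite card_injs => H.
  rewrite -(modulus_natM _ _ (ltW f1)) -(modulus_natM _ _ mg); apply: modulus_mono.
  by rewrite !ger0_norm // mulr_ge0 // ltW.
have sum2 : F1 * \sum_t u t ^+ 2 <= n`!%:R * M.
  have H := mcoef_sum2 fC fS fN f1 aI.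
  rewrite -(modulus_natM _ _ mg).
  have -> : F1 * \sum_t u t ^+ 2 = am (f 1%g * \sum_t `|mcoef f a (precomp a t)| ^+ 2).
    rewrite modulusM modulus_sum => [|t _]; last exact: exprn_ge0.
    by congr (_ * _); apply: eq_bigr => t _; rewrite expr2 modulusM modulus_norm.
  have S0 : 0 <= \sum_(t : 'S_d) `|mcoef f a (precomp a t)| ^+ 2.
    by apply: sumr_ge0 => t _; apply: exprn_ge0.
  apply: modulus_mono.
  by rewrite (ger0_norm (mulr_ge0 (ltW f1) S0)) (ger0_norm (mulr_ge0 (ler0n _ _) mg)).
have v01 t : 0 <= v t <= 1.
  rewrite divr_ge0 ?(ltW M0) //= ler_pdivrMr // mul1r; apply: modulus_mono.
  rewrite (ger0_norm mg).
  have tI : injective (precomp a t) by move=> i j; rewrite !ffunE => /aI /perm_inj.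
  have [g eg] := inj_extend aI tI.
  have -> : precomp a t = [ffun i => g (a i)] by apply/ffunP => i; rewrite eg ffunE.
  exact: mcoef_le.
have FK y : am (f y) <= 4 ^+ d * K * \sum_t #|[pred p | pinj p && intertwines y t
  p]|%:R * v t.
  have := pointwise_bound fC fS fN f1 fV y aI; rewrite card_injs => /(_ n0 n3') H.
  have {}H : (n ^_ d)%:R * M * am (f y) <=
     F1 * 4 ^+ d * \sum_t u t * #|[pred p | pinj p && intertwines y t p]|%:R.
    have -> : F1 * 4 ^+ d * \sum_t u t * #|[pred p | pinj p && intertwines y t p]|%:R =
      am (f 1%g * 4 ^+ d * \sum_t `|mcoef f a (precomp a t)| * #|[pred p | pinj p &&
        intertwines y t p]|%:R).
      rewrite !modulusM -(natrX algC) modulus_nat natrX modulus_sum => [|t _];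
        last exact: mulr_ge0.
      by congr (_ * _); apply: eq_bigr => t _;
        rewrite modulusM modulus_nat modulus_norm.
    have -> : (n ^_ d)%:R * M * am (f y) = am ((n ^_ d)%:R * mcoef f a a * `|f y|).
      by rewrite !modulusM modulus_nat modulus_norm.
    have S0 : 0 <= \sum_t `|mcoef f a (precomp a t)| * #|[pred p | pinj p &&
      intertwines y t p]|%:R.
      by apply: sumr_ge0 => t _; apply: mulr_ge0.
    have L0 : 0 <= (n ^_ d)%:R * mcoef f a a * `|f y| by rewrite !mulr_ge0.
    have R0 : 0 <= f 1%g * 4 ^+ d by rewrite mulr_ge0 ?exprn_ge0 // ltW.
    by apply: modulus_mono; rewrite (ger0_norm L0) (ger0_norm (mulr_ge0 R0 S0)).
  rewrite -(ler_pM2l (mulr_gt0 N0 M0)); apply: le_trans H _.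
  rewrite le_eqVlt; apply/orP; left; apply/eqP.
  rewrite !mulr_sumr; apply: eq_bigr => t _; rewrite /v /K; field.
  by rewrite !lt0r_neq0.
have vK : \sum_t v t ^+ 2 <= (d`!%:R * K ^+ 2)^-1.
  have -> : \sum_t v t ^+ 2 = (\sum_t u t ^+ 2) / M ^+ 2.
    by rewrite mulr_suml; apply: eq_bigr => t _; rewrite /v exprMn exprVn.
  have nE : n`!%:R = (n ^_ d)%:R * (n - d)`!%:R :> R by rewrite -natrM ffact_fact.
  have H1 : \sum_t u t ^+ 2 <= (n ^_ d)%:R * (n - d)`!%:R * M / F1.
    by rewrite ler_pdivlMr // mulrC -nE.
  rewrite ler_pdivrMr ?exprn_gt0 //; apply: le_trans H1 _.
  rewrite /K; have -> : (d`!%:R * (F1 / (n ^_ d)%:R) ^+ 2)^-1 * M ^+ 2 =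
     ((n ^_ d)%:R * M) * ((n ^_ d)%:R * M / (d`!%:R * F1 ^+ 2)) by field;
       rewrite !lt0r_neq0.
  have -> : (n ^_ d)%:R * (n - d)`!%:R * M / F1 = ((n ^_ d)%:R * M) * ((n - d)`!%:R /
    F1).
    by rewrite !mulrA [_ * M]mulrAC.
  rewrite ler_pM2l ?mulr_gt0 // ler_pdivlMr ?mulr_gt0 ?exprn_gt0 //.
  apply: le_trans kappa; rewrite natrM le_eqVlt; apply/orP; left; apply/eqP; field.
  by rewrite lt0r_neq0.
apply: le_trans (power_sum_bound q2 d0 K0 (fun y => modulus_ge0 _ (f y)) v01 FK vK) _.
rewrite !mulrA ler_wpM2l //.
  by rewrite exprn_ge0 // !mulr_ge0 ?expR_ge0 ?(ltW q0) // invr_ge0 ltW //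
    ln_gt0_of_ge2.
apply: powR_le; first exact: exponent_ge0.
  by rewrite mulr_ge0 ?(ltW K0).
have nd0 : 0 < n%:R ^+ d :> R by rewrite exprn_gt0 // ltr0n.
rewrite /K -/F1 mulrAC ler_pdivrMr // mulrAC ler_pdivlMr // -mulrA [leRHS]mulrAC mulrC.
rewrite ler_pM2r // -!natrX -!natrM ler_nat mulnC; exact: ffact_expn_le.
Qed.

End Final.

Theorem theorem1p13 (R : realType) :
  exists C : R, 0 < C /\
    forall (n d : nat) (q : R) (chi : 'CF(symg n)),
      (0 < d)%N -> 2 <= q ->
      chi \in irr (symg n) -> has_level chi d ->
      sym_Lnorm q (fun s : 'S_n => chi s) <=
        (C * q / ln q) ^+ d *
        ((d%:R ^+ d * algC_modulus R (chi 1%g)) / n%:R ^+ d) `^ (1 - 2 / q).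
Proof.
exists (16 * expR 2); split; first by rewrite mulr_gt0 ?expR_gt0.
move=> n d q chi d0 q2 irr_chi lev_chi.
have [e [dn fV [a aI m0]]] := level_twist d0 irr_chi lev_chi.
have amE s : algC_modulus R (chi s) = algC_modulus R (twist e chi s).
  by rewrite -[LHS]modulus_norm -(norm_twist e) modulus_norm.
rewrite /sym_Lnorm amE (eq_bigr (fun s => algC_modulus R (twist e chi s) `^ q)) => [|s
  _]; last by rewrite amE.
have f1 := twist_gt0 e irr_chi.
have [n3|n3] := leqP (3 * d) n.
  apply: (large_n_bound q2 (twistC e chi) (twist_schur e irr_chi) (twist_norm2 e
    irr_chi) f1 fV aI m0 d0 n3).
apply: small_n_bound => //.
- by apply: modulus_gt0; rewrite lt0r_neq0.
- move=> s; rewrite modulus_ge0 -!amE; apply: modulus_mono.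
  have /irrWchar chi_char := irr_chi.
  by rewrite (ger0_norm (char1_ge0 chi_char)) char1_ge_norm.
have := twist_norm2 e irr_chi => /(congr1 (algC_modulus R)); rewrite modulus_nat => <-.
rewrite modulus_sum => [|s _]; last exact: exprn_ge0.
by apply: eq_bigr => s _; rewrite [in RHS]expr2 [RHS]modulusM modulus_norm expr2.
Qed.
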